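(* Let $(X,d)$ be a proper discrete metric space equipped with an expanding and coherent combing $H$. Then: (1) for every $R>0$ there exists $S>R$ such that $\overline{P_R(X)}^{H}$ is contractible in $\overline{P_S(X)}^{H}$ (i.e. the inclusion $\overline{P_R(X)}^{H}\hookrightarrow\overline{P_S(X)}^{H}$ is homotopic to a constant map); (2) the $\sigma$-compact space $\overline{\mathcal P(X)}^{H}$ is contractible (as a $\sigma$-compact space); (3) the corona $\partial_HX$ is a $Z$-set in $\overline{\mathcal P(X)}^{H}$.
   Context: $\mathbb N=\{0,1,2,\dots\}$. A metric space is proper if its closed balls are compact. Combings. A combing on a metric space $(X,d)$ starting at $p\in X$ is a map $H\colon X\times\mathbb N\to X$, $H_n(x):=H(x,n)$, such that: (i) $H_0(x)=p=H_n(p)$ for all $x\in X$, $n\in\mathbb N$; (ii) for every bounded $K\subset X$ there is $N\in\mathbb N$ with $H_n(x)=x$ for all $x\in K$, $n\ge N$; (iii) $H$ is controlled: for every $r\ge0$ there is $s\ge 0$ such that $d(x,y)\le r$ and $|m-n|\le r$ imply $d(H_m(x),H_n(y))\le s$. No continuity is required. $H$ is coherent if there is $R_{coh}\ge0$ with $d(H_m(H_n(x)),H_m(x))\le R_{coh}$ for all $x\in X$ and all $m\le n$. $H$ is expanding if there is $R_{exp}>0$ such that for all $r>0$ and $n\in\mathbb N$ there is a bounded $K_{r,n}\subset X$ with $d(H_n(y),H_n(x))\le R_{exp}$ whenever $x\in X\setminus K_{r,n}$ and $d(x,y)\le r$. $H$ is proper if for every bounded $K\subset X$ there are a bounded $L\subset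 X$ and $N\in\mathbb N$ with $H_n^{-1}(K)\subset L$ for all $n\ge N$; coherent combings are proper, so the objects below are defined. Corona. A bounded function $f\colon X\to\mathbb C$ has vanishing variation if for every $r>0$ the function $x\mapsto\sup\{|f(y)-f(x)| : d(x,y)\le r\}$ vanishes at infinity (is arbitrarily small outside bounded sets). $D_0(X)$ is the $C^*$-algebra of bounded functions vanishing at infinity and $D_H(X)$ the $C^*$-algebra of all bounded functions $f$ of vanishing variation with $\|f\circ H_n-f\|_\infty\to0$ as $n\to\infty$. The combing corona $\partial_HX$ is the maximal ideal space of $D_H(X)/D_0(X)$. Rips complexes. $P_R(X)$ ($R\ge 0$) is (the geometric realization of) the simplicial complex whose simplices are the finite nonempty subsets of $X$ with mutual distances $\le R$; it is locally finite. Fix $\pi\colon P_R(X)\to X$ sending each point to a vertex of a simplex containing it; a subset $E\subset P_R(X)\times P_R(X)$ is an entourage iff $\sup\{d(\pi(u),\pi(v)):(u,v)\in E\}<\infty$. $\overline{P_R(X)}^{H}$ is the maximal ideal space of the $C^*$-algebra of all bounded continuous $f\colon P_R(X)\to\mathbb C$ which have vanishing variation (for each entourage $E$, $u\mapsto\sup\{|f(v)-f(u)|:(v,u)\in E\}$ vanishes at infinity) and satisfy $f|_X\in D_H(X)$. This is the combing compactification of $P_R(X)$ for the combing transported from $X$ along the coarse equivalence $X\subset P_R(X)$; its boundary $\overline{P_R(X)}^{H}\setminus P_R(X)$ is canonically $\partial_HX$, and $\overline{P_R(X)}^{H}\subset\overline{P_S(X)}^{H}$ is a closed subspace for $R\le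 S$. $\sigma$-spaces. A $\sigma$-compact space is an increasing sequence $Y_0\subset Y_1\subset\dots$ of compact Hausdorff spaces, each $Y_m$ closed in $Y_n$ with the subspace topology for $m\le n$; one also writes $\mathcal Y=\bigcup_nY_n$ with the final topology. $\overline{\mathcal P(X)}^{H}:=\bigcup_{R\in\mathbb N}\overline{P_R(X)}^{H}$. It is contractible as a $\sigma$-compact space if there is a continuous map $h\colon\mathcal Y\times[0,1]\to\mathcal Y$ from the identity to a constant map such that for every $m$ there is $n$ with $h(Y_m\times[0,1])\subset Y_n$. A closed subset $Z$ of a topological space $\overline Y$ is a $Z$-set if there is a homotopy $h\colon\overline Y\times[0,1]\to\overline Y$ with $h_0=\mathrm{id}$ and $h_t(\overline Y)\subset\overline Y\setminus Z$ for all $t>0$. *)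

(* Defs.v *)
From HB Require Import structures.
From mathcomp Require Import all_boot all_order all_algebra generic_quotient.
From mathcomp Require Import ring_quotient finmap complex.
From mathcomp Require Import all_classical all_reals all_analysis.
Set Implicit Arguments.
Unset Strict Implicit.
Unset Printing Implicit Defensive.
Import Order.TTheory GRing.Theory Num.Theory.
Import numFieldNormedType.Exports.
Local Open Scope classical_set_scope.
Local Open Scope ring_scope.
Local Open Scope quotient_scope.

(* The regular module [R[i]^o] is the copy of [R[i]] carrying the topology. *)
Notation Cplx R := ((complex R)^o).
Notation modulus := ComplexField.Normc.normc.

(* A unital subalgebra of the algebra of all functions [T -> C]; the norm and
   the involution are not needed to define its maximal ideal space. *)
Record funalg (R : realType) (T : Type) := FunAlg {
  funalg_set : set (T -> Cplx R);
  funalg_cst : forall a, funalg_set (fun=> a);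
  funalgB : forall f g, funalg_set f -> funalg_set g -> funalg_set (f - g);
  funalgM : forall f g, funalg_set f -> funalg_set g -> funalg_set (f * g) }.

Section funalg_closed.
Context (R : realType) (T : Type) (A : funalg R T).

Definition funalg_pred : {pred T -> Cplx R} := [pred f | `[< funalg_set A f >]].

Lemma funalg_subring_closed : GRing.subring_closed funalg_pred.
Proof.
split=> [|f g /asboolP Af /asboolP Ag|f g /asboolP Af /asboolP Ag];
  apply/asboolP; [exact: funalg_cst|exact: funalgB|exact: funalgM].
Qed.

HB.instance Definition _ :=
  GRing.isSubringClosed.Build (T -> Cplx R) funalg_pred funalg_subring_closed.

Lemma funalg_subsemimod_closed : GRing.subsemimod_closed funalg_pred.
Proof.
split; first by split=> [|f g]; [exact: rpred0|exact: rpredD].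
move=> a f Af; rewrite (_ : a *: f = (fun=> a) * f)//.
by rewrite rpredM//; apply/asboolP; exact: funalg_cst.
Qed.

Definition funalg_sort : Type := {f : T -> Cplx R | f \in funalg_pred}.

HB.instance Definition _ := [isSub of funalg_sort for @sval _ _].
HB.instance Definition _ := [Choice of funalg_sort by <:].
HB.instance Definition _ := GRing.SubChoice_isSubComPzRing.Build
  (T -> Cplx R) funalg_pred funalg_sort funalg_subring_closed.
HB.instance Definition _ := GRing.SubZmodule_isSubLmodule.Build (Cplx R)
  (T -> Cplx R) funalg_pred funalg_sort funalg_subsemimod_closed.

End funalg_closed.

Coercion funalg_sort : funalg >-> Sortclass.

Section max_ideal_space.
Context (R : realType) (T : Type) (A : funalg R T).

(* Maximal ideals of a commutative unital C*-algebra are the kernels of its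
   characters (unital algebra morphisms to C; these are automatically
   continuous), and the maximal ideal space carries the topology of pointwise
   convergence of characters. *)
Definition is_character (chi : A -> Cplx R) : Prop :=
  linear chi /\ GRing.monoid_morphism chi.

Definition max_ideal_space : topologicalType :=
  [set chi : {ptws A -> Cplx R} | is_character chi].

(* The same for the quotient [A / I]: its operations are induced along [\pi]. *)
Definition quot_max_ideal_space (I : zmodClosed A) : topologicalType :=
  [set chi : {ptws Quotient.quot I -> Cplx R} |
    is_character (chi \o \pi_(Quotient.quot I))].

Definition quot_max_ideal_space_lift (I : zmodClosed A)
    (chi : quot_max_ideal_space I) : max_ideal_space :=
  exist _ (val chi \o \pi_(Quotient.quot I) : {ptws A -> Cplx R})
    (mem_set (set_mem (valP chi) : is_character (val chi \o \pi_(_)))).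

Lemma max_ideal_space_eval_continuous (f : A) :
  continuous (fun chi : max_ideal_space => val chi f).
Proof.
move=> chi; apply: (@continuous_comp max_ideal_space {ptws A -> Cplx R}
  (Cplx R) val (fun psi => psi f)).
  exact: initial_continuous.
exact: (@proj_continuous A (fun=> Cplx R) f).
Qed.

Lemma max_ideal_space_continuous (Z : topologicalType)
    (h : Z -> max_ideal_space) :
  (forall f, continuous (fun z => val (h z) f)) -> continuous h.
Proof.
move=> hf z U [_ [[V oV <-] Vhz] VU].
have hz : {ptws, ((val \o h) @ z) --> (val (h z) : A -> Cplx R)}.
  apply/cvg_sup => f W [_ [[G oG <-] Ghz] OW].
  by apply: filterS OW _; apply: (hf f); exact: open_nbhs_nbhs.
apply: filterS VU _; apply: hz; exact: open_nbhs_nbhs.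
Qed.

End max_ideal_space.

Section pullback.
Context (R : realType) (S T : Type) (A : funalg R S) (B : funalg R T).
Variable g : S -> T.
Hypothesis gP : forall f, funalg_set B f -> funalg_set A (f \o g).

Lemma restrict_subproof (f : B) : val f \o g \in funalg_pred A.
Proof. by apply/asboolP/gP/asboolP; exact: valP f. Qed.

Definition restrict (f : B) : A := exist _ (val f \o g) (restrict_subproof f).

Lemma restrict_linear : linear restrict.
Proof. by move=> a f f'; apply: val_inj. Qed.

Lemma restrict_monoid_morphism : GRing.monoid_morphism restrict.
Proof. by split=> [|f f']; apply: val_inj. Qed.

Lemma restrict_character (chi : A -> Cplx R) :
  is_character chi -> is_character (chi \o restrict).
Proof.
move=> [lchi [chi1 chiM]]; split=> [a f f'|] /=.
  by rewrite restrict_linear lchi.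
by split=> [|f f'] /=;
  rewrite ?restrict_monoid_morphism.1 ?restrict_monoid_morphism.2.
Qed.

Lemma restrict_character_set (chi : max_ideal_space A) :
  (val chi \o restrict : {ptws B -> Cplx R}) \in
    [set psi : {ptws B -> Cplx R} | is_character psi].
Proof. by apply/mem_set/restrict_character; exact: set_mem (valP chi). Qed.

Definition induced (chi : max_ideal_space A) : max_ideal_space B :=
  exist _ (val chi \o restrict : {ptws B -> Cplx R})
    (restrict_character_set chi).

Lemma induced_continuous : continuous induced.
Proof.
apply: max_ideal_space_continuous => f.
exact: max_ideal_space_eval_continuous.
Qed.

End pullback.


Section oscillation.
Context (R : realType) (T : Type).
Implicit Types f g : T -> Cplx R.

Definition bounded_function f : Prop :=
  exists M : R, forall u, modulus (f u) <= M.

Lemma bounded_functionP f : bounded_function f ->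
  exists2 M : R, 0 < M & forall u, modulus (f u) <= M.
Proof.
move=> [M fM]; exists (`|M| + 1); first by rewrite ltr_wpDl.
by move=> u; rewrite (le_trans (fM u))// (le_trans (ler_norm M))// lerDl.
Qed.

Lemma modulus_ge0 (z : Cplx R) : 0 <= modulus z.
Proof. by case: z => a b; exact: sqrtr_ge0. Qed.

Lemma modulus0 : modulus (0 : Cplx R) = 0.
Proof. exact: ComplexField.Normc.normc0. Qed.

Lemma modulusM (a b : Cplx R) : modulus (a * b) = modulus a * modulus b.
Proof. exact: ComplexField.Normc.normcM. Qed.

Lemma modulusN (a : Cplx R) : modulus (- a) = modulus a.
Proof. exact: normcN. Qed.

Lemma modulusD (a b : Cplx R) : modulus (a + b) <= modulus a + modulus b.
Proof. exact: le_normcD. Qed.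

Lemma modulusB (a b : Cplx R) : modulus (a - b) <= modulus a + modulus b.
Proof. by rewrite -(modulusN b) modulusD. Qed.

Lemma bounded_function_cst a : bounded_function (fun=> a).
Proof. by exists (modulus a). Qed.

Lemma bounded_functionB f g : bounded_function f -> bounded_function g ->
  bounded_function (f - g).
Proof.
move=> [M fM] [N gN]; exists (M + N) => u.
by rewrite (le_trans (modulusB _ _))// lerD.
Qed.

Lemma bounded_functionM f g : bounded_function f -> bounded_function g ->
  bounded_function (f * g).
Proof.
move=> [M fM] [N gN]; exists (M * N) => u.
by rewrite modulusM ler_pM// modulus_ge0.
Qed.

Context (I : Type) (G : set_system I) {GF : Filter G} (S : I -> set (T * T)).

Definition oscillation f (i : I) : R :=
  sup [set modulus (f ab.1 - f ab.2) | ab in S i].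

Lemma oscillation_cvg0P f : bounded_function f ->
  (oscillation f @ G --> 0) <->
  (forall e, 0 < e ->
     G [set i | forall a b, S i (a, b) -> modulus (f a - f b) < e]).
Proof.
move=> /bounded_functionP[M M0 fM].
have ub i : has_ubound [set modulus (f ab.1 - f ab.2) | ab in S i].
  exists (M + M) => _ [ab _ <-].
  by rewrite (le_trans (modulusB _ _))// lerD.
split=> [/cvgrPdist_lt h e e0|h].
  apply: filterS (h e e0) => i /= + a b Sab; rewrite sub0r normrN.
  move=> /(le_lt_trans (ler_norm _)); apply: le_lt_trans.
  by apply: ub_le_sup; [exact: ub|exists (a, b)].
apply/cvgrPdist_le => e e0; apply: filterS (h e e0) => i /= he.
rewrite sub0r normrN /oscillation ger0_norm.
  have [->|S0] := eqVneq (S i) set0; first by rewrite image_set0 sup0 ltW.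
  apply: ge_sup; last by move=> _ [[a b] Sab <-]; exact/ltW/he.
  move/set0P : S0 => [ab Sab].
  by exists (modulus (f ab.1 - f ab.2)), ab.
have [->|/set0P[ab Sab]] := eqVneq (S i) set0; first by rewrite image_set0 sup0.
apply: (@le_trans _ _ (modulus (f ab.1 - f ab.2))); first exact: modulus_ge0.
by apply: ub_le_sup; [exact: ub|exists ab].
Qed.

Lemma oscillation_cst a : oscillation (fun=> a) @ G --> 0.
Proof.
apply/oscillation_cvg0P; first exact: bounded_function_cst.
by move=> e e0; apply: filterS filterT => i _ b c _; rewrite subrr modulus0.
Qed.

Lemma oscillationB f g : bounded_function f -> bounded_function g ->
  oscillation f @ G --> 0 -> oscillation g @ G --> 0 ->
  oscillation (f - g) @ G --> 0.
Proof.
move=> bf bg /(oscillation_cvg0P bf) hf /(oscillation_cvg0P bg) hg.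
apply/oscillation_cvg0P; first exact: bounded_functionB.
move=> e e0; have e20 : 0 < e / 2 by rewrite divr_gt0.
apply: filterS2 (hf _ e20) (hg _ e20) => i /= hfi hgi a b Sab.
rewrite [X in modulus X](_ : _ = (f a - f b) - (g a - g b)); last first.
  transitivity ((f a - g a) - (f b - g b)) => //.
  by rewrite opprD [in RHS]opprD addrACA.
by rewrite (le_lt_trans (modulusB _ _))// (splitr e) ltrD// ?hfi ?hgi.
Qed.

Lemma oscillationM f g : bounded_function f -> bounded_function g ->
  oscillation f @ G --> 0 -> oscillation g @ G --> 0 ->
  oscillation (f * g) @ G --> 0.
Proof.
move=> bf bg /(oscillation_cvg0P bf) hf /(oscillation_cvg0P bg) hg.
apply/oscillation_cvg0P; first exact: bounded_functionM.
move: bf bg => /bounded_functionP[M M0 fM] /bounded_functionP[N N0 gN].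
move=> e e0; have e20 : 0 < e / 2 by rewrite divr_gt0.
have eN : 0 < e / 2 / N by rewrite divr_gt0.
have eM : 0 < e / 2 / M by rewrite divr_gt0.
apply: filterS2 (hf _ eN) (hg _ eM) => i /= hfi hgi a b Sab.
rewrite [X in modulus X](_ : _ =
    (f a - f b) * g a + f b * (g a - g b)); last first.
  by rewrite mulrBl mulrBr addrA subrK.
rewrite (le_lt_trans (modulusD _ _))// (splitr e) !modulusM ltrD//.
  rewrite (@le_lt_trans _ _ (modulus (f a - f b) * N))//.
    by rewrite ler_wpM2l ?modulus_ge0.
  by rewrite -ltr_pdivlMr// hfi.
rewrite mulrC (@le_lt_trans _ _ (modulus (g a - g b) * M))//.
  by rewrite ler_wpM2l ?modulus_ge0.
by rewrite -ltr_pdivlMr// hgi.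
Qed.

End oscillation.

Section combing.
Context (R : realType) (X : metricType R).

(* Notions relative to the coarse structure pulled back along [pi : T -> X];
   [X] itself is the case [pi = id]. *)
Section pulled_back.
Context (T : Type) (pi : T -> X).

Definition bounded (B : set T) : Prop :=
  exists M, forall u v, B u -> B v -> mdist (pi u) (pi v) <= M.

Definition coarse_entourage (E : set (T * T)) : Prop :=
  exists M, forall uv, E uv -> mdist (pi uv.1) (pi uv.2) <= M.

(* [f @ at_infinity --> 0] says that [f] is arbitrarily small outside bounded
   sets; the filter is improper when [T] is bounded. *)
Definition at_infinity : set_system T :=
  [set A | exists2 B, bounded B & ~` B `<=` A].

Lemma bounded0 : bounded set0.
Proof. by exists 0. Qed.

Lemma boundedU B1 B2 : bounded B1 -> bounded B2 -> bounded (B1 `|` B2).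
Proof.
move=> b1 b2.
have [->|/set0P[x B1x]] := eqVneq B1 set0; first by rewrite set0U.
have [->|/set0P[y B2y]] := eqVneq B2 set0; first by rewrite setU0.
move: b1 b2 => [M hM] [N hN].
have M0 : 0 <= M := le_trans (mdist_ge0 _ _) (hM x x B1x B1x).
have N0 : 0 <= N := le_trans (mdist_ge0 _ _) (hN y y B2y B2y).
have key u v : B1 u -> B2 v ->
    mdist (pi u) (pi v) <= M + mdist (pi x) (pi y) + N.
  move=> Bu Bv; apply: le_trans (metric_triangle _ (pi y) _) _.
  rewrite lerD ?hN//; apply: le_trans (metric_triangle _ (pi x) _) _.
  by rewrite lerD ?hM.
exists (M + mdist (pi x) (pi y) + N) => u v [Bu|Bu] [Bv|Bv].
- by rewrite (le_trans (hM _ _ Bu Bv))// -addrA lerDl addr_ge0// mdist_ge0.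
- exact: key.
- by rewrite metric_sym key.
- by rewrite (le_trans (hN _ _ Bu Bv))// lerDr addr_ge0// mdist_ge0.
Qed.

#[global] Instance at_infinity_filter : Filter at_infinity.
Proof.
split; first by exists set0; [exact: bounded0|].
- move=> P Q [B bB BP] [C bC CQ]; exists (B `|` C); first exact: boundedU.
  by rewrite setCU => x [Bx Cx]; split; [exact: BP|exact: CQ].
- by move=> P Q PQ [B bB BP]; exists B => // x /BP/PQ.
Qed.

Definition variation (E : set (T * T)) (f : T -> Cplx R) (u : T) : R :=
  sup [set modulus (f v - f u) | v in [set v | E (v, u)]].

Lemma variationE E f :
  variation E f = oscillation (fun u => E `&` [set vu | vu.2 = u]) f.
Proof.
apply/funext => u; congr sup; apply/seteqP; split => x /=.
  by move=> [v Evu <-]; exists (v, u).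
by move=> [[v w] /= [Evw <-] <-]; exists v.
Qed.

End pulled_back.

Definition proper_metric : Prop :=
  forall (x : X) (r : R), compact [set y | mdist x y <= r].

Definition is_combing (p : X) (H : X -> nat -> X) : Prop :=
  [/\ forall x, H x 0%N = p,
      forall n, H p n = p,
      forall K, bounded id K ->
        exists N : nat, forall x n, K x -> (N <= n)%N -> H x n = x
    & forall r : R, 0 <= r -> exists2 s : R, 0 <= s &
        forall x y m n, mdist x y <= r -> `|m%:R - n%:R| <= r ->
          mdist (H x m) (H y n) <= s].

Definition coherent (H : X -> nat -> X) : Prop :=
  exists2 Rcoh : R, 0 <= Rcoh &
    forall x m n, (m <= n)%N -> mdist (H (H x n) m) (H x m) <= Rcoh.

Definition expanding (H : X -> nat -> X) : Prop :=
  exists2 Rexp : R, 0 < Rexp &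
    forall (r : R) (n : nat), 0 < r -> exists2 K, bounded id K &
      forall x y, ~ K x -> mdist x y <= r -> mdist (H y n) (H x n) <= Rexp.

Section corona.
Variable H : X -> nat -> X.

Definition combing_fun : set (X -> Cplx R) :=
  [set f | [/\ bounded_function f,
    forall r : R, 0 < r ->
      variation [set vu | mdist vu.2 vu.1 <= r] f @ at_infinity id --> 0
  & (fun n => sup [set modulus (f (H x n) - f x) | x in [set: X]]) @ \oo
      --> (0 : R)]].

Lemma combing_funE f : combing_fun f <->
  [/\ bounded_function f,
    forall r : R, 0 < r ->
      oscillation (fun u => [set vu | mdist vu.2 vu.1 <= r]
        `&` [set vu | vu.2 = u]) f @ at_infinity id --> 0
  & oscillation (fun n => [set yx | yx.1 = H yx.2 n]) f @ \oo --> 0].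
Proof.
rewrite (_ : oscillation _ f =
  fun n => sup [set modulus (f (H x n) - f x) | x in [set: X]]).
  by split=> -[? h ?]; split=> // r /h; rewrite variationE.
apply/funext => n; congr sup; apply/seteqP; split => y /=.
  by move=> [[a b] /= -> <-]; exists b.
by move=> [x _ <-]; exists (H x n, x).
Qed.

Lemma combing_fun_cst a : combing_fun (fun=> a).
Proof.
by apply/combing_funE; split=> *;
  [exact: bounded_function_cst|exact: oscillation_cst|exact: oscillation_cst].
Qed.

Lemma combing_funB f g : combing_fun f -> combing_fun g -> combing_fun (f - g).
Proof.
move=> /combing_funE[bf vf hf] /combing_funE[bg vg hg].
apply/combing_funE; split=> [|r r0|]; first exact: bounded_functionB.
  by apply: oscillationB => //; [exact: vf|exact: vg].
exact: oscillationB.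
Qed.

Lemma combing_funM f g : combing_fun f -> combing_fun g -> combing_fun (f * g).
Proof.
move=> /combing_funE[bf vf hf] /combing_funE[bg vg hg].
apply/combing_funE; split=> [|r r0|]; first exact: bounded_functionM.
  by apply: oscillationM => //; [exact: vf|exact: vg].
exact: oscillationM.
Qed.

Definition DH : funalg R X := FunAlg combing_fun_cst combing_funB combing_funM.

(* D_0(X), as an ideal of D_H(X). *)
Definition D0 : {pred DH} :=
  [pred f | `[< val f @ at_infinity id --> (0 : Cplx R) >]].

Lemma D0_zmod_closed : GRing.zmod_closed D0.
Proof.
split=> [|f g /asboolP f0 /asboolP g0]; apply/asboolP; first exact: cvg_cst.
rewrite -[X in _ --> X](subrr 0); exact: cvgB.
Qed.

HB.instance Definition _ := GRing.isZmodClosed.Build DH D0 D0_zmod_closed.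

Definition corona : topologicalType := quot_max_ideal_space D0.

End corona.

Section rips.

Definition is_simplex (r : R) (s : {fset X}) : Prop :=
  s != fset0 /\ forall x y, x \in s -> y \in s -> mdist x y <= r.

(* A point of the geometric realization is the function of its barycentric
   coordinates; its support is the simplex whose interior contains it. *)
Definition is_rips_point (r : R) (u : {fsfun X -> R with 0}) : Prop :=
  [/\ forall x, 0 <= u x, \sum_(x <- finsupp u) u x = 1
    & is_simplex r (finsupp u)].

Variable r : {nonneg R}.

Record rips := RipsPoint {
  bary :> {fsfun X -> R with 0};
  baryP : is_rips_point r%:num bary }.

Lemma rips_eq (u v : rips) : bary u = bary v -> u = v.
Proof.
by case: u v => [u up] [v vp] /= uv; subst v; rewrite (Prop_irrelevance up vp).
Qed.

HB.instance Definition _ := gen_eqMixin rips.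
HB.instance Definition _ := gen_choiceMixin rips.

Definition face (s : {fset X}) : set rips := [set u | (finsupp u `<=` s)%fset].

(* The weak topology: each closed simplex carries its Euclidean topology, that
   is, the topology of pointwise convergence of barycentric coordinates. *)
Definition rips_open (U : set rips) : Prop :=
  forall s, is_simplex r%:num s -> exists2 V : set {ptws X -> R}, open V &
    forall u, face s u -> (U u <-> V (bary u : X -> R)).

Lemma rips_openT : rips_open setT.
Proof. by move=> s _; exists setT; first exact: openT. Qed.

Lemma rips_openI : setI_closed rips_open.
Proof.
move=> A B oA oB s ss; have [V oV AV] := oA s ss; have [W oW BW] := oB s ss.
exists (V `&` W); first exact: openI.
by move=> u su; have ? := AV u su; have ? := BW u su; rewrite /setI/=; tauto.
Qed.

Lemma rips_open_bigU (I : Type) (F : I -> set rips) :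
  (forall i, rips_open (F i)) -> rips_open (\bigcup_i F i).
Proof.
move=> oF s ss.
have /choice[V VP] : forall i, exists V : set {ptws X -> R}, open V /\
    forall u, face s u -> (F i u <-> V (bary u : X -> R)).
  by move=> i; have [V oV FV] := oF i s ss; exists V.
exists (\bigcup_i V i); first by apply: bigcup_open => i _; exact: (VP i).1.
move=> u su; split=> -[i _ Fi]; exists i => //; exact/(VP i).2.
Qed.

HB.instance Definition _ :=
  isOpenTopological.Build rips rips_openT rips_openI rips_open_bigU.

Lemma finsupp_vertex (x : X) :
  finsupp ([fsfun y in [fset x]%fset => 1 | 0] : {fsfun X -> R with 0}) =
  [fset x]%fset.
Proof.
apply/fsetP => y; rewrite mem_finsupp fsfunE.
by case: ifP => //; rewrite ?oner_eq0 ?eqxx.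
Qed.

Lemma vertexP (x : X) :
  is_rips_point r%:num [fsfun y in [fset x]%fset => 1 | 0].
Proof.
split=> [y||]; first by rewrite fsfunE; case: ifP.
  by rewrite finsupp_vertex big_seq_fset1 fsfunE inE eqxx.
rewrite finsupp_vertex; split=> [|y z].
  by apply/fset0Pn; exists x; rewrite inE.
by rewrite !inE => /eqP -> /eqP ->; rewrite mdistxx.
Qed.

Definition vertex (x : X) : rips := RipsPoint (vertexP x).

Record rips_proj := RipsProj {
  rips_proj_fun :> rips -> X;
  rips_projP : forall u, exists s,
    [/\ is_simplex r%:num s, face s u & rips_proj_fun u \in s] }.

End rips.

Section rips_incl.
Variables (r s : {nonneg R}) (rs : r%:num <= s%:num).

Lemma rips_incl_subproof (u : rips r) : is_rips_point s%:num u.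
Proof.
have [u0 u1 [un0 ur]] := baryP u; split=> //; split=> // x y xu yu.
by rewrite (le_trans _ rs)// ur.
Qed.

Definition rips_incl (u : rips r) : rips s := RipsPoint (rips_incl_subproof u).

Lemma rips_incl_continuous : continuous rips_incl.
Proof.
apply/continuousP => A oA; change (rips_open (rips_incl @^-1` A)) => t tr.
have ts : is_simplex s%:num t.
  by split=> [|x y xt yt]; [exact: tr.1|exact: le_trans (tr.2 x y xt yt) rs].
have [V oV AV] := oA t ts.
by exists V => // u tu; exact: AV.
Qed.

Lemma rips_incl_vertex (x : X) : rips_incl (vertex r x) = vertex s x.
Proof. exact: rips_eq. Qed.

Lemma rips_incl_proj (p : rips_proj r) (q : rips_proj s) (u : rips r) :
  mdist (p u) (q (rips_incl u)) <= s%:num + s%:num.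
Proof.
have [t [tr tu pt]] := rips_projP p u.
have [t' [t's t'u qt']] := rips_projP q (rips_incl u).
have [_ _ [/fset0Pn[x xu] _]] := baryP u.
apply: le_trans (metric_triangle _ x _) _; apply: lerD.
  by rewrite (le_trans _ rs)// tr.2// (fsubsetP tu).
by rewrite t's.2// (fsubsetP t'u).
Qed.

Lemma rips_incl_bounded (p : rips_proj r) (q : rips_proj s) (B : set (rips s)) :
  bounded q B -> bounded p (rips_incl @^-1` B).
Proof.
move=> [M BM]; exists ((s%:num + s%:num) + M + (s%:num + s%:num)) => u v Bu Bv.
apply: le_trans (metric_triangle _ (q (rips_incl v)) _) _; apply: lerD.
  apply: le_trans (metric_triangle _ (q (rips_incl u)) _) _.
  by rewrite lerD ?rips_incl_proj ?BM.
by rewrite metric_sym rips_incl_proj.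
Qed.

Lemma rips_incl_entourage (p : rips_proj r) (q : rips_proj s) E :
  coarse_entourage p E ->
  coarse_entourage q [set (rips_incl uv.1, rips_incl uv.2) | uv in E].
Proof.
move=> [M EM]; exists ((s%:num + s%:num) + M + (s%:num + s%:num)).
move=> _ [[u v] Euv <-] /=.
apply: le_trans (metric_triangle _ (p v) _) _; apply: lerD.
  apply: le_trans (metric_triangle _ (p u) _) _.
  by rewrite lerD ?(EM _ Euv)// metric_sym rips_incl_proj.
exact: rips_incl_proj.
Qed.

End rips_incl.

Section compactification.
Variable H : X -> nat -> X.

Section one_scale.
Variables (r : {nonneg R}) (p : rips_proj r).

Definition rips_fun : set (rips r -> Cplx R) :=
  [set f | [/\ bounded_function f, continuous f,
    forall E, coarse_entourage p E -> variation E f @ at_infinity p --> 0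
  & combing_fun H (f \o @vertex r)]].

Lemma rips_fun_cst a : rips_fun (fun=> a).
Proof.
split; [exact: bounded_function_cst|exact: cst_continuous| |
  exact: combing_fun_cst].
by move=> E _; rewrite variationE; exact: oscillation_cst.
Qed.

Lemma rips_funB f g : rips_fun f -> rips_fun g -> rips_fun (f - g).
Proof.
move=> [bf cf vf hf] [bg cg vg hg]; split.
- exact: bounded_functionB.
- by move=> u; exact: (@cvgB R[i] (Cplx R) _ _ _ _ _ _ _ (cf u) (cg u)).
- move=> E cE; rewrite variationE; apply: oscillationB => //.
    by rewrite -variationE; exact: vf.
  by rewrite -variationE; exact: vg.
- exact: combing_funB hf hg.
Qed.

Lemma rips_funM f g : rips_fun f -> rips_fun g -> rips_fun (f * g).
Proof.
move=> [bf cf vf hf] [bg cg vg hg]; split.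
- exact: bounded_functionM.
- by move=> u; exact: (@cvgM R[i] _ _ _ _ _ _ _ (cf u) (cg u)).
- move=> E cE; rewrite variationE; apply: oscillationM => //.
    by rewrite -variationE; exact: vf.
  by rewrite -variationE; exact: vg.
- exact: combing_funM hf hg.
Qed.

Definition DP : funalg R (rips r) := FunAlg rips_fun_cst rips_funB rips_funM.

Definition rips_compactification : topologicalType := max_ideal_space DP.

End one_scale.

Section two_scales.
Variables (r s : {nonneg R}) (p : rips_proj r) (q : rips_proj s).
Variable rs : r%:num <= s%:num.

Lemma rips_fun_incl f : rips_fun q f -> rips_fun p (f \o rips_incl rs).
Proof.
move=> [bf cf vf hf]; split.
- by case: bf => M fM; exists M => u; exact: fM.
- by move=> u; apply: continuous_comp; [exact: rips_incl_continuous|exact: cf].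
- move=> E /(rips_incl_entourage rs q)/vf; rewrite !variationE.
  have bfi : bounded_function (f \o rips_incl rs).
    by case: bf => M fM; exists M => u; exact: fM.
  move=> /(oscillation_cvg0P _ bf) h; apply/(oscillation_cvg0P _ bfi) => e e0.
  have [B bB Bh] := h _ e0.
  exists (rips_incl rs @^-1` B); first exact: rips_incl_bounded bB.
  move=> u /Bh /= {}h a b [Eab bu]; apply: h.
  by split; [exists (a, b)|rewrite /= -bu].
- rewrite (_ : _ \o _ = f \o @vertex s)//.
  by apply/funext => x /=; rewrite rips_incl_vertex.
Qed.

Definition compactification_incl :
    rips_compactification p -> rips_compactification q :=
  induced (A := DP p) (B := DP q) rips_fun_incl.

End two_scales.
Arguments compactification_incl {r s} p q rs chi.

Lemma compactification_incl_comp (r s t : {nonneg R})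
    (p : rips_proj r) (q : rips_proj s) (o : rips_proj t)
    (rs : r%:num <= s%:num) (st : s%:num <= t%:num) (rt : r%:num <= t%:num)
    (chi : rips_compactification p) :
  compactification_incl q o st (compactification_incl p q rs chi) =
  compactification_incl p o rt chi.
Proof.
apply: val_inj; apply/funext => f /=; congr (val chi _); apply: val_inj => /=.
by apply/funext => u /=; congr (val f _); exact: rips_eq.
Qed.

Lemma rips_fun_vertex (r : {nonneg R}) (p : rips_proj r) f :
  rips_fun p f -> combing_fun H (f \o @vertex r).
Proof. by case. Qed.

(* The canonical map from the corona onto the boundary of the compactification:
   [chi |-> (f |-> chi [f|_X])]. *)
Definition corona_map (r : {nonneg R}) (p : rips_proj r) :
    corona H -> rips_compactification p :=
  induced (A := DH H) (B := DP p) (@rips_fun_vertex r p) \o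
    @quot_max_ideal_space_lift _ _ _ _.

Lemma corona_map_incl (r s : {nonneg R}) (p : rips_proj r) (q : rips_proj s)
    (rs : r%:num <= s%:num) (chi : corona H) :
  compactification_incl p q rs (corona_map p chi) = corona_map q chi.
Proof.
apply: val_inj; apply/funext => f /=; congr (val chi _); apply: congr1.
by apply: val_inj; apply/funext => x /=; congr (val f _); exact: rips_eq.
Qed.

End compactification.
End combing.
Arguments compactification_incl {R X H r s} p q rs chi.

(* The inclusions of an increasing sequence of spaces are given as maps. *)
Record sigma_sequence := SigmaSequence {
  stage :> nat -> topologicalType;
  transition : forall m n, (m <= n)%N -> stage m -> stage n;
  transition_continuous : forall m n (mn : (m <= n)%N),
    continuous (transition mn);
  transition_comp : forall m n k (mn : (m <= n)%N) (nk : (n <= k)%N)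
      (mk : (m <= k)%N) (y : stage m),
    transition nk (transition mn y) = transition mk y }.

Section sigma_union.
Variable Y : sigma_sequence.

(* Points are identified when they agree in some common later stage. *)
Definition stage_equiv (x y : {n & Y n}) : bool :=
  `[< exists k (xk : (projT1 x <= k)%N) (yk : (projT1 y <= k)%N),
      transition xk (projT2 x) = transition yk (projT2 y) >].

Lemma stage_equiv_class_of : equiv_class_of stage_equiv.
Proof.
split=> [x|x y|y x z]; rewrite /stage_equiv.
- by apply/asboolP; exists (projT1 x), (leqnn _), (leqnn _).
- apply: asbool_equiv_eq.
  by split=> -[k [xk [yk e]]]; exists k, yk, xk; rewrite e.
- move=> /asboolP[k [xk [yk e]]] /asboolP[l [yl [zl e']]]; apply/asboolP.
  have km := leq_maxl k l; have lm := leq_maxr k l.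
  exists (maxn k l), (leq_trans xk km), (leq_trans zl lm).
  rewrite -(transition_comp xk km) e (transition_comp yk km (leq_trans yk km)).
  rewrite -(transition_comp yl lm) e'.
  by rewrite (transition_comp zl lm (leq_trans zl lm)).
Qed.

Canonical stage_equiv_equiv := EquivRelPack stage_equiv_class_of.
Canonical stage_equiv_encModRel := defaultEncModRel stage_equiv.

(* The final topology is the quotient of the topological sum. *)
Definition sigma_union : topologicalType :=
  quotient_topology {eq_quot stage_equiv}.

Definition sigma_in (n : nat) (y : Y n) : sigma_union :=
  (\pi_(quotient_topology {eq_quot stage_equiv}) (existT _ n y)).

End sigma_union.

Section homotopy.
Variable R : realType.

Definition unit_interval : topologicalType := `[0 : R, 1]%classic.

Definition homotopic (A B : topologicalType) (f g : A -> B) : Prop :=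
  exists h : A * unit_interval -> B,
    [/\ continuous h,
        forall a t, \val t = 0 -> h (a, t) = f a
      & forall a t, \val t = 1 -> h (a, t) = g a].

Definition sigma_contractible (Y : sigma_sequence) : Prop :=
  exists h : sigma_union Y * unit_interval -> sigma_union Y,
    [/\ continuous h,
        forall y t, \val t = 0 -> h (y, t) = y,
        exists y0, forall y t, \val t = 1 -> h (y, t) = y0
      & forall m, exists n, forall (y : Y m) t,
          exists z : Y n, h (sigma_in y, t) = sigma_in z].

Definition Z_set (Y : topologicalType) (Z : set Y) : Prop :=
  closed Z /\
  exists h : Y * unit_interval -> Y,
    [/\ continuous h,
        forall y t, \val t = 0 -> h (y, t) = y
      & forall y t, 0 < \val t -> ~ Z (h (y, t))].

End homotopy.

Section sigma_compactification.
Context (R : realType) (X : metricType R) (H : X -> nat -> X).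
Variable p : forall r : {nonneg R}, rips_proj X r.

Definition nat_scale (n : nat) : {nonneg R} := n%:R%:nng.

Lemma nat_scale_le m n : (m <= n)%N -> (nat_scale m)%:num <= (nat_scale n)%:num.
Proof. by rewrite /= ler_nat. Qed.

Program Definition sigma_compactification : sigma_sequence :=
  {| stage := fun n => rips_compactification H (p (nat_scale n));
     transition := fun m n mn =>
       compactification_incl (p (nat_scale m)) (p (nat_scale n))
         (nat_scale_le mn) |}.
Next Obligation. by move=> m n mn; exact: induced_continuous. Qed.
Next Obligation.
by move=> m n k mn nk mk chi; exact: compactification_incl_comp.
Qed.

Lemma sigma_in_transition (Y : sigma_sequence) m n (mn : (m <= n)%N) (y : Y m) :
  sigma_in (transition mn y) = sigma_in y.
Proof.
apply/eqmodP/asboolP; exists n, (leqnn n), mn => /=.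
exact: transition_comp.
Qed.

(* The corona as a subset of the union; its image does not depend on the stage
   in which it is taken. *)
Definition sigma_corona : set (sigma_union sigma_compactification) :=
  range (fun chi : corona H =>
    @sigma_in sigma_compactification 0 (corona_map (p (nat_scale 0)) chi)).

Lemma sigma_corona_stage n : sigma_corona = range (fun chi : corona H =>
  @sigma_in sigma_compactification n (corona_map (p (nat_scale n)) chi)).
Proof.
congr image; apply/funext => chi.
rewrite -(corona_map_incl (p (nat_scale 0)) _ (nat_scale_le (leq0n n))).
by rewrite (@sigma_in_transition sigma_compactification 0 n (leq0n n)).
Qed.

End sigma_compactification.
Arguments sigma_corona {R X} H p.

(* Main.v *)
Require Import Defs.
From mathcomp Require Import all_boot all_order all_algebra generic_quotient.
From mathcomp Require Import ring_quotient finmap complex.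
From mathcomp Require Import all_classical all_reals all_analysis.
From mathcomp Require Import ring lra.
Set Implicit Arguments.
Unset Strict Implicit.
Unset Printing Implicit Defensive.
Import Order.TTheory GRing.Theory Num.Theory.
Import numFieldNormedType.Exports.
Local Open Scope classical_set_scope.
Local Open Scope ring_scope.
Local Open Scope quotient_scope.

(* Each map [H_n] has finite range. Expansion and coherence make the cut-offs
   of [x |-> d(H_n x, a)] at a large scale almost elements of [D_H(X)];
   alternating a Lipschitz-type smoothing with precomposition by [H_m], [m]
   large, and passing to the limit turns them into elements of [D_H(X)].
   Normalising these bump functions replaces [H_n] by a map [G_n] from [X] to
   the probability measures on the range of [H_n] which stays uniformly close
   to [H_n] and whose coordinates lie in [D_H(X)]. Interpolating affinely in
   [n] and extending affinely over simplices yields a homotopy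
   [P_R(X) * [0, 1] -> P_S(X)] from the inclusion to a constant map. Because it
   maps into a finite subcomplex at each positive time, where continuous
   functions are uniformly continuous, precomposition with it maps the
   function algebra of [P_S(X)] to that of [P_R(X)], norm-continuously in time;
   hence it extends to the compactifications. The formula does not depend on
   the scales, so the homotopies fit together on the union, and since finitely
   many barycentric coordinates add up to [1] on a finite subcomplex whereas
   each of them vanishes on the corona, the corona is left immediately. *)

(** * Steady functions on a space with a combing *)

Lemma compact_discrete_finite (T : topologicalType) (K : set T) :
  (forall x : T, open [set x]) -> compact K -> finite_set K.
Proof.
move=> dT /compact_near_coveringP cK.
pose F := filter_from (@finite_set T) (fun D => [set E | D `<=` E]).
have FF : Filter F.
  apply: filter_from_filter; first by exists set0; exact: finite_set0.
  move=> D E fD fE; exists (D `|` E); first by rewrite finite_setU.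
  by move=> G DEG; split=> x Gx; apply: DEG; [left|right].
have [x Kx|D fD] := cK _ F (fun E => [set x | E x]) FF.
  exists ([set x], [set E | E x]) => /=.
    split; first exact/open_nbhs_nbhs.
    by exists [set x]; [exact: finite_set1|move=> E; exact].
  by case=> y E /= [-> ].
by move=> /(_ D (@subset_refl _ _)) KD; exact: sub_finite_set KD fD.
Qed.

Lemma nested_intervals (R : realType) (a b : nat -> R) :
  (forall j k, a j <= b k) -> exists c, forall j, a j <= c <= b j.
Proof.
move=> ab; exists (sup (range a)) => j; apply/andP; split.
  by apply: ub_le_sup; [exists (b 0%N) => _ [k _ <-]|exists j].
by apply: ge_sup => [|_ [k _ <-]]; [exists (a 0%N), 0%N|exact: ab].
Qed.

Section combing_facts.
Context (R : realType) (X : metricType R).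
Hypothesis X_proper : proper_metric X.
Hypothesis X_discrete : forall x : X, open [set x].
Variables (x0 : X) (H : X -> nat -> X).
Hypothesis H_combing : is_combing x0 H.
Implicit Types (x y a : X) (f : X -> R) (e r M : R).

Local Notation nrm x := (mdist x0 x).

Lemma finite_ball M : finite_set [set x | nrm x <= M].
Proof. by apply: compact_discrete_finite. Qed.

Lemma discrete_dist y : exists2 d : R, 0 < d & forall x, mdist x y < d -> x = y.
Proof.
have := open_nbhs_nbhs (conj (X_discrete y) (erefl y)).
rewrite -(@metricType_numDomainType.filter_from_mdist_nbhs R X).
by move=> [d d0 h]; exists d => // x; rewrite metric_sym => /h.
Qed.

Lemma nrm_ge x y : nrm x - mdist x y <= nrm y.
Proof.
by have := metric_triangle x0 y x; rewrite (metric_sym y x) lerBlDr.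
Qed.

Lemma boundedP (K : set X) :
  bounded id K <-> exists M, forall x, K x -> nrm x <= M.
Proof.
split=> [[M KM]|[M KM]]; last first.
  exists (M + M) => u v /KM Ku /KM Kv.
  apply: le_trans (metric_triangle _ x0 _) _.
  by rewrite lerD// metric_sym.
have [->|/set0P[y Ky]] := eqVneq K set0; first by exists 0.
exists (nrm y + M) => x Kx; apply: le_trans (metric_triangle _ y _) _.
by rewrite lerD2l; exact: KM.
Qed.

Lemma combing0 x : H x 0%N = x0.
Proof. by case: H_combing. Qed.

Lemma combing_id M :
  exists N : nat, forall x n, nrm x <= M -> (N <= n)%N -> H x n = x.
Proof.
have [_ _ h _] := H_combing.
have [|N hN] := h [set x | nrm x <= M]; first by apply/boundedP; exists M.
by exists N => x n; exact: hN.
Qed.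

Lemma combing_control r : exists2 s : R, 0 <= s &
  forall x y m n, mdist x y <= r -> `|m%:R - n%:R| <= r ->
    mdist (H x m) (H y n) <= s.
Proof.
have [_ _ _ h] := H_combing.
have [s s0 hs] := h `|r| (normr_ge0 r); exists s => // x y m n xy mn.
by apply: hs; [apply: le_trans xy _|apply: le_trans mn _]; exact: ler_norm.
Qed.

Lemma combing_range n : finite_set (range (H ^~ n)).
Proof.
have [s _ hs] := combing_control n%:R.
apply: (sub_finite_set _ (finite_ball s)) => _ [x _ <-] /=.
rewrite -(combing0 x); apply: hs; first by rewrite mdistxx.
by rewrite sub0r normrN ger0_norm.
Qed.

Hypothesis H_expanding : expanding H.
Hypothesis H_coherent : coherent H.

Lemma combing_close : exists2 C : R, 0 < C &
  (forall x m n, (m <= n)%N -> mdist (H (H x n) m) (H x m) <= C) /\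
  (forall r n, exists M, forall x y, M < nrm x -> mdist x y <= r ->
    mdist (H y n) (H x n) <= C).
Proof.
move: H_expanding H_coherent => [Re Re0 He] [Rc Rc0 Hc].
exists (Re + Rc); first by rewrite ltr_wpDr.
split=> [x m n mn|r n]; first by rewrite (le_trans (Hc _ _ _ mn))// lerDr ltW.
have [|K /boundedP[M KM] hK] := He (`|r| + 1) n; first by rewrite ltr_wpDl.
exists M => x y Mx xy; rewrite (@le_trans _ _ Re)// ?lerDl// hK//.
  by move=> /KM; rewrite leNgt Mx.
by rewrite (le_trans xy)// (le_trans (ler_norm r))// lerDl.
Qed.

(* Once [H_n x] lies in a bounded set [K], with [n] large, coherence prevents
   the path [m |-> H_m x] from leaving a neighbourhood of [K] after time [n],
   and this path ends in [x]. *)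
Lemma combing_proper M : exists M' (N : nat), forall x n,
  (N <= n)%N -> nrm (H x n) <= M -> nrm x <= M'.
Proof.
have [Rc Rc0 Hc] := H_coherent.
have [s s0 hs] := combing_control 1.
have [N HN] := combing_id (M + Rc + s).
exists (M + Rc), N => x n Nn xM.
have near m : (n <= m)%N -> nrm (H x m) <= M + Rc.
  elim: m => [|m IH].
    by rewrite leqn0 => /eqP <-; rewrite (le_trans xM)// lerDl.
  rewrite leq_eqVlt => /predU1P[<-|nm]; first by rewrite (le_trans xM)// lerDl.
  have mS : nrm (H x m.+1) <= M + Rc + s.
    apply: le_trans (metric_triangle _ (H x m) _) _.
    rewrite lerD ?IH// hs ?mdistxx//.
    by rewrite -natr1 opprD addrA subrr sub0r normrN normr1.
  have := Hc x n m.+1 (ltnW nm); rewrite HN// => h.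
  by apply: le_trans (metric_triangle _ (H x n) _) _; rewrite lerD// metric_sym.
have [N' HN'] := combing_id (nrm x).
have := near (maxn n N') (leq_maxl _ _).
by rewrite HN'// leq_maxr.
Qed.

(* Bounds the defect of [f] from satisfying the two conditions defining
   [D_H(X)]. *)
Definition defect_le f e : Prop :=
  (forall r, exists M, forall x y, M < nrm x -> mdist x y <= r ->
     `|f x - f y| <= e) /\
  (exists N, forall n, (N <= n)%N -> forall x, `|f (H x n) - f x| <= e).

Definition steady f : Prop := forall e, 0 < e -> defect_le f e.

(* The supremum over [y] of the cones [f y - g y * mdist x y], where the slope
   [g y] is the least one for which the cone stays below [f + e]. *)
Lemma smoothing f e : 0 < e ->
  (forall x, 0 <= f x <= 1) ->
  (forall r, exists M, forall x y, M < nrm x -> mdist x y <= r ->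
     `|f x - f y| <= e) ->
  exists f1 : X -> R, [/\ forall x, 0 <= f1 x <= 1,
    forall x, f x <= f1 x <= f x + e
    & forall r d, 0 < d -> exists M, forall x y, M < nrm x -> mdist x y <= r ->
     `|f1 x - f1 y| <= d].
Proof.
move=> e0 f01 fe.
have /choice[g gP] y : exists g : R, [/\ 0 <= g,
    forall x, f y <= f x + e + g * mdist x y
  & forall r, 0 < r -> (forall x, mdist x y <= r -> f y <= f x + e) ->
      g <= r^-1].
  pose S := [set z | z = 0 \/
    exists2 x, x != y & z = (f y - f x - e) / mdist x y].
  have ubS : has_ubound S.
    have [d d0 hd] := discrete_dist y; exists d^-1 => _ [->|[x xy ->]].
      by rewrite invr_ge0 ltW.
    have dxy : 0 < mdist x y by rewrite mdist_gt0.
    have dd : d <= mdist x y.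
      by rewrite leNgt; apply/negP => /hd /eqP; rewrite (negbTE xy).
    rewrite ler_pdivrMr// (@le_trans _ _ 1)//.
      by have := f01 y; have := f01 x; lra.
    by rewrite mulrC ler_pdivlMr// mul1r.
  exists (sup S); split=> [|x|r r0 h].
  - by apply: ub_le_sup => //; left.
  - have [->|xy] := eqVneq x y; first by rewrite mdistxx mulr0 addr0 lerDl ltW.
    rewrite -lerBlDl -ler_pdivrMr ?mdist_gt0//.
    by apply: ub_le_sup => //; right; exists x => //; rewrite opprD addrA.
  - apply: ge_sup => [|_ [->|[x xy ->]]]; first by exists 0; left.
      by rewrite invr_ge0 ltW.
    have dxy : 0 < mdist x y by rewrite mdist_gt0.
    have [xr|rx] := leP (mdist x y) r.
      rewrite (@le_trans _ _ 0)// ?invr_ge0 ?(ltW r0)//.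
      by rewrite pmulr_lle0 ?invr_gt0//; have := h x xr; lra.
    rewrite ler_pdivrMr// mulrC ler_pdivlMr//.
    rewrite (@le_trans _ _ r) ?(ltW rx)// ger_pMl//.
    by have := f01 y; have := f01 x; lra.
pose cones x := [set f y - g y * mdist x y | y in [set: X]].
have ub_cones x : ubound (cones x) (f x + e).
  by move=> _ [y _ <-]; rewrite lerBlDr; have [_ + _] := gP y; exact.
have ub1 x : ubound (cones x) 1.
  move=> _ [y _ <-]; have [g0 _ _] := gP y.
  have := mulr_ge0 g0 (mdist_ge0 x y); have := f01 y; lra.
pose f1 x := sup (cones x).
have f1_ge x y : f y - g y * mdist x y <= f1 x.
  by apply: ub_le_sup; [exists 1; exact: ub1|exists y].
have f1_le x c : ubound (cones x) c -> f1 x <= c.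
  by move=> h; apply: ge_sup => //; exists (f x - g x * mdist x x), x.
have f_le x : f x <= f1 x by have := f1_ge x x; rewrite mdistxx mulr0 subr0.
have f1_0 x : 0 <= f1 x by have := f_le x; have := f01 x; lra.
exists f1; split=> [x|x|r d d0].
- by rewrite f1_0 f1_le.
- by rewrite f_le f1_le.
pose r0 := `|r| + 1; have r00 : 0 < r0 by rewrite ltr_wpDl.
have rr0 : r <= r0 by rewrite (le_trans (ler_norm r))// lerDl.
have [M hM] := fe (r0 / d).
exists (M + r0 / d + r0).
suff key x y : M + r0 / d < nrm x -> mdist x y <= r0 -> f1 x <= f1 y + d.
  move=> x y Mx xy; have {}xy := le_trans xy rr0.
  have Mx' : M + r0 / d < nrm x by lra.
  have My : M + r0 / d < nrm y by have := nrm_ge x y; lra.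
  have h1 := key _ _ Mx' xy; have h2 : f1 y <= f1 x + d.
    by apply: key => //; rewrite metric_sym.
  by rewrite ler_norml; lra.
move=> Mx xy; apply: f1_le => _ [z _ <-]; have [g0 gle gM] := gP z.
have [gd|gd] := leP (g z) (d / r0).
  have h1 := f1_ge y z.
  have h2 : g z * mdist y z <= g z * mdist x z + d.
    have h3 : g z * mdist y z <= g z * (mdist x z + r0).
      rewrite ler_wpM2l// addrC.
      by rewrite (le_trans (metric_triangle y x z))// lerD2r metric_sym.
    have h4 : g z * r0 <= d by rewrite -ler_pdivlMr.
    by rewrite mulrDr in h3; lra.
  lra.
have zM : nrm z <= M.
  rewrite leNgt; apply/negP => Mz.
  suff /(gM _ (divr_gt0 r00 d0)) : forall u, mdist u z <= r0 / d ->
      f z <= f u + e by rewrite invf_div leNgt gd.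
  move=> u uz; have := hM z u Mz; rewrite metric_sym => /(_ uz).
  by rewrite ler_norml; lra.
have xz : r0 / d <= mdist x z.
  by have := metric_triangle x0 z x; rewrite (metric_sym z x); lra.
have : 1 <= g z * mdist x z.
  have <- : d / r0 * (r0 / d) = 1 by rewrite mulrA divfK ?divff ?gt_eqF.
  by apply: ler_pM xz; rewrite ?divr_ge0 ?ltW.
by have := f01 z; have := f1_0 y; lra.
Qed.

Lemma improve f e : 0 < e -> (forall x, 0 <= f x <= 1) -> defect_le f e ->
  exists f1 : X -> R, [/\ forall x, 0 <= f1 x <= 1,
    forall x, `|f1 x - f x| <= 2 * e & defect_le f1 (e / 2)].
Proof.
move=> e0 f01 [fe [N fN]].
have [f1 [f101 f1f f1s]] := smoothing e0 f01 fe.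
have e20 : 0 < e / 2 by rewrite divr_gt0.
have [C C0 [Hcoh Hexp]] := combing_close.
have [M hM] := f1s C _ e20.
have [L [N1 hL]] := combing_proper M.
have [N2 hN2] := combing_id L.
pose m := maxn N N1.
have Nm : (N <= m)%N := leq_maxl _ _.
have N1m : (N1 <= m)%N := leq_maxr _ _.
exists (fun x => f1 (H x m)); split=> [x|x|].
- exact: f101.
- have := f1f (H x m); have := fN m Nm x; rewrite !ler_norml; lra.
split=> [r|].
  have [M1 hM1] := Hexp r m; exists (Num.max L M1) => x y.
  rewrite gt_max => /andP[Lx Mx] xy; apply: hM; last first.
    by rewrite metric_sym; exact: hM1.
  by rewrite ltNge; apply/negP => /(hL _ _ N1m); rewrite leNgt Lx.
exists (maxn m N2) => n; rewrite geq_max => /andP[mn N2n] x.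
have [Mx|xM] := ltP M (nrm (H x m)).
  rewrite distrC; apply: hM => //; rewrite metric_sym; exact: Hcoh.
by rewrite (hN2 x n) ?subrr ?normr0 ?(ltW e20)//; exact: hL N1m xM.
Qed.

Lemma exists_steady f e : 0 < e -> (forall x, 0 <= f x <= 1) ->
  defect_le f e -> exists f1 : X -> R, [/\ forall x, 0 <= f1 x <= 1,
    forall x, `|f1 x - f x| <= 4 * e & steady f1].
Proof.
move=> e0 f01 fe.
pose ok (k : nat) (h : X -> R) :=
  (forall x, 0 <= h x <= 1) /\ defect_le h (e / 2 ^+ k).
have ek k : 0 < e / 2 ^+ k by rewrite divr_gt0 ?exprn_gt0.
have /choice[F FP] (kh : nat * (X -> R)) : exists h1, ok kh.1 kh.2 ->
    ok kh.1.+1 h1 /\ forall x, `|h1 x - kh.2 x| <= 2 * (e / 2 ^+ kh.1).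
  have [[h01 hk]|no] := pselect (ok kh.1 kh.2); last by exists f.
  have [h1 [h101 h1h h1k]] := improve (ek kh.1) h01 hk.
  exists h1 => _; split=> //; split=> //.
  by rewrite exprSr invfM mulrA.
pose s := fix s k := if k is j.+1 then F (j, s j) else f.
have sk k : ok k (s k).
  elim: k => [|k IH] /=; first by split; rewrite // expr0 divr1.
  by have [] := FP (k, s k) IH.
have step k x : `|s k.+1 x - s k x| <= 2 * (e / 2 ^+ k).
  by have [_] := FP (k, s k) (sk k); exact.
have far k j x : `|s (k + j)%N x - s k x| <=
    4 * (e / 2 ^+ k) - 4 * (e / 2 ^+ (k + j)).
  elim: j => [|j IH]; first by rewrite addn0 !subrr normr0.
  rewrite addnS; apply: le_trans (ler_distD (s (k + j)%N x) _ _) _.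
  have := lerD (step (k + j)%N x) IH; rewrite [_ ^+ (k + j).+1]exprSr invfM.
  rewrite [e * (_ * _)]mulrA; lra.
have /choice[f1 f1P] x : exists c : R, forall k,
    s k x - 4 * (e / 2 ^+ k) <= c <= s k x + 4 * (e / 2 ^+ k).
  apply: nested_intervals => j k.
  have [jk|kj] := leqP j k.
    have := far j (k - j)%N x; rewrite subnKC// ler_norml.
    by have := ek k; lra.
  have := far k (j - k)%N x; rewrite (subnKC (ltnW kj)) ler_norml.
  by have := ek j; lra.
have small (d : R) : 0 < d -> exists k, 4 * (e / 2 ^+ k) <= d.
  move=> d0; pose k := Num.Def.archi_bound (4 * e / d); exists k.
  have hk : 4 * e / d < 2 ^+ k := upper_nthrootP (leqnn _).
  by rewrite mulrA ler_pdivrMr ?exprn_gt0// [leRHS]mulrC -ler_pdivrMr// ltW.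
have f1k k x : `|f1 x - s k x| <= 4 * (e / 2 ^+ k).
  by have := f1P x k; rewrite ler_norml; lra.
exists f1; split=> [x|x|d d0].
- suff h d : 0 < d -> - d <= f1 x <= 1 + d.
    apply/andP; split; apply/ler_addgt0Pr => d /h; lra.
  move=> /small[k hk]; have := f1k k x; have := (sk k).1 x.
  by rewrite ler_norml; lra.
- by have := f1k 0%N x; rewrite expr0 divr1.
have d30 : 0 < d / 3 by rewrite divr_gt0.
have [k hk] := small _ d30.
have [h1 [N h2]] := (sk k).2; have ekk := ek k; split=> [r|].
  have [M hM] := h1 r; exists M => x y Mx xy; have := hM x y Mx xy.
  have := f1k k x; have := f1k k y; rewrite !ler_norml; lra.
exists N => n Nn x; have := h2 n Nn x.
have := f1k k x; have := f1k k (H x n); rewrite !ler_norml; lra.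
Qed.

(* The cut-off of [mdist (H x n) a] at a large scale is nearly steady because
   [n] is fixed; a steady function close to it separates. *)
Lemma bump_functions : exists2 L : R, 0 <= L &
  forall n a, exists f : X -> R, [/\ forall x, 0 <= f x <= 1, steady f,
    forall x, f x != 0 -> mdist (H x n) a <= L
  & forall x, H x n = a -> 1 / 2 <= f x].
Proof.
have [C C0 [Hcoh Hexp]] := combing_close.
exists (16 * C); first by rewrite mulr_ge0 ?ltW.
move=> n a.
pose f0 x := Num.max 0 (1 - mdist (H x n) a / (16 * C)).
have C16 : 0 < 16 * C by rewrite mulr_gt0.
have f001 x : 0 <= f0 x <= 1.
  rewrite /f0 le_max lexx ge_max ler01/= gerBl.
  by rewrite divr_ge0 ?mdist_ge0 ?ltW.
have f0_lip x y : mdist (H x n) (H y n) <= C -> f0 y <= f0 x + 16^-1.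
  move=> xy; rewrite /f0.
  have : mdist (H x n) a / (16 * C) <= mdist (H y n) a / (16 * C) + 16^-1.
    have -> : 16^-1 = C / (16 * C) :> R.
      by rewrite invfM mulrCA divff ?mulr1 ?gt_eqF.
    rewrite -mulrDl ler_pM2r ?invr_gt0// addrC.
    by rewrite (le_trans (metric_triangle _ (H y n) _))// lerD2r.
  rewrite !maxEle; case: ifP; case: ifP; lra.
have f0_dist x y : mdist (H x n) (H y n) <= C -> `|f0 x - f0 y| <= 16^-1.
  move=> xy; have h1 := f0_lip _ _ xy; have h2 : f0 x <= f0 y + 16^-1.
    by apply: f0_lip; rewrite metric_sym.
  by rewrite ler_norml; lra.
have [||f [f01 ff0 fs]] := @exists_steady f0 16^-1 _ f001; first by lra.
  split=> [r|].
    have [M hM] := Hexp r n; exists M => x y Mx xy.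
    by apply: f0_dist; rewrite metric_sym hM.
  by exists n => m nm x; exact/f0_dist/Hcoh.
pose g x := Num.max 0 (f x - 4^-1).
exists g; split=> [x||x|x xa].
- by rewrite /g le_max lexx ge_max ler01/=; have := f01 x; lra.
- move=> e e0; have [h1 [N h2]] := fs e e0; split=> [r|].
    have [M hM] := h1 r; exists M => x y Mx xy; have := hM x y Mx xy.
    by rewrite /g !maxEle !ler_norml; case: ifP; case: ifP; lra.
  exists N => m Nm x; have := h2 m Nm x.
  by rewrite /g !maxEle !ler_norml; case: ifP; case: ifP; lra.
- apply: contraTT; rewrite -ltNge negbK => Lx; apply/eqP/max_idPl.
  have f00 : f0 x = 0.
    apply/max_idPl; rewrite subr_le0 ler_pdivlMr// mul1r; exact: ltW.
  by have := ff0 x; rewrite f00 ler_norml; lra.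
- have f0a : f0 x = 1.
    by rewrite /f0 xa mdistxx mul0r subr0; apply/max_idPr.
  by rewrite /g le_max; have := ff0 x; rewrite f0a ler_norml; lra.
Qed.

Lemma defect_seq (s : seq X) (f : X -> X -> R) e :
  (forall a, a \in s -> defect_le (f a) e) ->
  (forall r, exists M, forall x y, M < nrm x -> mdist x y <= r ->
     forall a, a \in s -> `|f a x - f a y| <= e) /\
  (exists N, forall n, (N <= n)%N -> forall x,
     forall a, a \in s -> `|f a (H x n) - f a x| <= e).
Proof.
elim: s => [|b s IH] h; first by split=> [r|]; [exists 0|exists 0%N].
have [|h1 [N1 h2]] := IH; first by move=> a sa; apply: h; rewrite inE sa orbT.
have [|h1b [N2 h2b]] := h b; first by rewrite inE eqxx.
split=> [r|].
  have [M1 hM1] := h1 r; have [M2 hM2] := h1b r.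
  exists (Num.max M1 M2) => x y; rewrite gt_max => /andP[xM1 xM2] xy a.
  by rewrite inE => /predU1P[->|]; [exact: hM2|exact: hM1].
exists (maxn N1 N2) => n; rewrite geq_max => /andP[n1 n2] x a.
by rewrite inE => /predU1P[->|]; [exact: h2b|exact: h2].
Qed.

Lemma ler_dist_quotient (p q s t d k : R) : 1 / 2 <= s -> 1 / 2 <= t ->
  0 <= q <= t -> `|p - q| <= d -> `|s - t| <= k ->
  `|p / s - q / t| <= 2 * (d + k).
Proof.
move=> s2 t2 /andP[q0 qt] pq st.
have s0 : 0 < s by lra.
have t0 : 0 < t by lra.
have k0 : 0 <= k := le_trans (normr_ge0 _) st.
have -> : p / s - q / t = (p - q - q / t * (s - t)) / s.
  rewrite [in RHS]mulrBr divfK ?gt_eqF// opprB addrA subrK.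
  by rewrite mulrBl mulfK ?gt_eqF.
rewrite normrM normrV ?unitfE ?gt_eqF// (gtr0_norm s0) ler_pdivrMr//.
apply: (@le_trans _ _ (d + k)).
  apply: le_trans (ler_normB _ _) _; rewrite lerD// normrM.
  rewrite -[leRHS]mul1r ler_pM// ger0_norm ?divr_ge0 ?(ltW t0)//.
  by rewrite ler_pdivrMr// mul1r.
have : 0 <= d + k by rewrite addr_ge0// (le_trans _ pq).
by move=> dk; rewrite mulrAC ler_peMl//; lra.
Qed.

Lemma steady_weights : exists2 L : R, 0 <= L &
  exists (F : nat -> {fset X}) (G : nat -> X -> X -> R),
  [/\ forall n x a, 0 <= G n x a,
      forall n x a, G n x a != 0 -> a \in F n /\ mdist (H x n) a <= L,
      forall n x, \sum_(a <- F n) G n x a = 1,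
      forall n a, steady (G n ^~ a)
    & F 0%N = [fset x0]%fset /\
      forall M, exists N, forall n x, (N <= n)%N -> nrm x <= M ->
        forall a, G n x a = (a == x)%:R].
Proof.
have [L L0 bump] := bump_functions; exists L => //.
have /choice[phi phiP] (na : nat * X) := bump na.1 na.2.
pose F n := fset_set (range (H ^~ n)).
have FE n a : (a \in F n) = (a \in range (H ^~ n)).
  by rewrite in_fset_set//; exact: combing_range.
have FH n x : H x n \in F n by rewrite FE; apply/mem_set; exists x.
pose S n x := \sum_(a <- F n) phi (n, a) x.
have phi01 n a x : 0 <= phi (n, a) x <= 1 by have [+ _ _ _] := phiP (n, a).
have phi_le n a x : a \in F n -> phi (n, a) x <= S n x.
  move=> Fa; rewrite /S (big_fsetD1 a)//= lerDl.
  by apply: sumr_ge0 => b _; have /andP[] := phi01 n b x.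
have S2 n x : 1 / 2 <= S n x.
  apply: le_trans (phi_le n (H x n) x (FH n x)).
  by have [_ _ _ +] := phiP (n, H x n); exact.
have S0 n x : 0 < S n x by have := S2 n x; lra.
pose G n x a := if nrm x <= n%:R then (a == H x n)%:R
  else if a \in F n then phi (n, a) x / S n x else 0.
exists F, G; split.
- move=> n x a; rewrite /G; case: ifP => // _; case: ifP => // _.
  by rewrite divr_ge0 ?(ltW (S0 _ _))//; have /andP[] := phi01 n a x.
- move=> n x a; rewrite /G; case: ifP => [_|_].
    have [->|_] := eqVneq a (H x n); last by rewrite eqxx.
    by move=> _; split => //; rewrite mdistxx.
  case: ifP => [Fa|_]; last by rewrite eqxx.
  have [_ _ supp _] := phiP (n, a).
  by rewrite mulf_eq0 negb_or => /andP[/supp].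
- move=> n x; rewrite /G; have [nx|nx] := boolP (nrm x <= n%:R).
    by rewrite (big_fsetD1 (H x n))//= eqxx big_seq big1 ?addr0// => a;
      rewrite !inE => /andP[/negbTE ->].
  transitivity (\sum_(a <- F n) phi (n, a) x / S n x).
    by apply: eq_big_seq => a ->.
  rewrite -mulr_suml; exact/divff/lt0r_neq0/S0.
- move=> n a e e0.
  pose m := (size (F n)).
  pose d := e / (2 * (1 + m%:R)).
  have m0 : 0 < 2 * (1 + m%:R) :> R by rewrite mulr_gt0// ltr_wpDr.
  have d0 : 0 < d by rewrite divr_gt0.
  have quot x y : n%:R < nrm x -> n%:R < nrm y ->
      (forall b, b \in F n -> `|phi (n, b) x - phi (n, b) y| <= d) ->
      `|G n x a - G n y a| <= e.
    move=> nx ny h; rewrite /G !(leNgt _ n%:R) nx ny /=.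
    case: ifP => [Fa|_]; last by rewrite subrr normr0 ltW.
    rewrite (_ : e = 2 * (d + d * m%:R)); last first.
      by rewrite -{1}[d]mulr1 -mulrDr mulrCA divfK ?gt_eqF.
    apply: ler_dist_quotient; rewrite ?S2 ?h ?phi_le ?andbT//.
      by have /andP[] := phi01 n a y.
    rewrite /S -sumrB; apply: le_trans (ler_norm_sum _ _ _) _.
    have -> : d * m%:R = \sum_(b <- F n) d.
      by rewrite big_const_seq count_predT iter_addr_0 mulr_natr.
    by rewrite big_seq [leRHS]big_seq ler_sum.
  have [|h1 [N h2]] := @defect_seq (F n) (fun b => phi (n, b)) d.
    by move=> b _; have [_ + _ _] := phiP (n, b); exact.
  split=> [r|].
    have [M hM] := h1 r; exists (Num.max M (n%:R + `|r|)) => x y.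
    rewrite gt_max => /andP[Mx nx] xy; apply: quot => [||b Fb].
    + by rewrite (le_lt_trans _ nx)// lerDl.
    + have := nrm_ge x y; have := ler_norm r; lra.
    + exact: hM.
  have [M' [N1 hM']] := combing_proper n%:R.
  have [N2 hN2] := combing_id (Num.max M' n%:R).
  exists (maxn N (maxn N1 N2)) => k; rewrite !geq_max => /and3P[Nk N1k N2k] x.
  have [xM|] := leP (nrm x) (Num.max M' n%:R).
    by rewrite hN2// subrr normr0 ltW.
  rewrite gt_max => /andP[M'x nx]; apply: quot => // [|b Fb]; last exact: h2.
  by rewrite ltNge; apply/negP => /(hM' _ _ N1k); rewrite leNgt M'x.
split.
  apply/fsetP => a; rewrite FE inE; apply/idP/eqP => [/set_mem[x _ <-]|->].
    exact: combing0.
  by apply/mem_set; exists x0; rewrite ?combing0.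
move=> M; have [N hN] := combing_id M.
pose k := Num.Def.archi_bound `|M|.
have hk : `|M| < k%:R by exact: archi_boundP.
exists (maxn N k) => n x; rewrite geq_max => /andP[Nn kn] xM a.
rewrite /G ifT ?hN// (le_trans xM)// (le_trans (ler_norm M))//.
by rewrite (le_trans (ltW hk))// ler_nat.
Qed.

Record contracting_weights (L : R) (A : R -> {fset X}) (g : R -> X -> X -> R) :
    Prop := ContractingWeights {
  weight_ge0 : forall t x a, 0 <= t -> 0 <= g t x a;
  weight_supp : forall t x a, 0 <= t -> g t x a != 0 -> a \in A t;
  weight_dist : forall t x a, 0 <= t -> g t x a != 0 ->
    mdist (H x (Num.truncn t)) a <= L;
  weight_sum : forall t x, 0 <= t -> \sum_(a <- A t) g t x a = 1;
  weight_steady : forall t a, 0 <= t -> steady (g t ^~ a);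
  weight_lip : forall t s x a, 0 <= t -> 0 <= s ->
    `|g t x a - g s x a| <= `|t - s|;
  weight_start : forall x a, g 0 x a = (a == x0)%:R;
  weight_end : forall M, exists T, forall t x a, T <= t -> nrm x <= M ->
    g t x a = (a == x)%:R;
  weight_range : forall T, exists B : {fset X}, forall t, 0 <= t -> t <= T ->
    (A t `<=` B)%fset }.

Definition interpolate (c : nat -> R) (t : R) : R :=
  let n := Num.truncn t in
  (1 - (t - n%:R)) * c n + (t - n%:R) * c n.+1.

Lemma interpolate_lip c t s : (forall n, 0 <= c n <= 1) -> 0 <= t -> 0 <= s ->
  `|interpolate c t - interpolate c s| <= `|t - s|.
Proof.
move=> c01; wlog ts : t s / t <= s.
  move=> h t0 s0; have [ts|/ltW st] := leP t s; first exact: h.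
  by rewrite distrC [leRHS]distrC; exact: h.
move=> t0 s0; rewrite [leRHS]distrC (ger0_norm (_ : 0 <= s - t)) ?subr_ge0//.
rewrite /interpolate.
have /andP[nt tn] := truncn_itv t0; have /andP[ms sm] := truncn_itv s0.
set n := Num.truncn t in nt tn *; set m := Num.truncn s in ms sm *.
have nm : (n <= m)%N.
  by rewrite -ltnS -(ltr_nat R) (le_lt_trans nt)// (le_lt_trans ts).
rewrite -natr1 in tn; rewrite -natr1 in sm.
have := c01 n; have := c01 n.+1; have := c01 m; have := c01 m.+1.
move: nm; rewrite leq_eqVlt => /predU1P[<-|nm].
  rewrite [X in `|X|](_ : _ = (s - t) * (c n - c n.+1)); last by ring.
  move=> *; rewrite normrM ger0_norm ?subr_ge0// ler_piMr ?subr_ge0//.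
  by rewrite ler_norml; lra.
have : `|c n.+1 - c m| <= m%:R - (n%:R + 1).
  move: nm; rewrite leq_eqVlt => /predU1P[<-|].
    by rewrite subrr normr0 -natr1 subrr.
  rewrite -(ler_nat R) -!natr1 => nm.
  by have := c01 m; have := c01 n.+1; rewrite ler_norml; lra.
move: (c n) (c n.+1) (c m) (c m.+1) => c0 c1 d0 d1 cd *.
rewrite [X in `|X|](_ : _ = (1 - (t - n%:R)) * (c0 - c1) + (c1 - d0) +
  (s - m%:R) * (d0 - d1)); last by ring.
have -> : s - t = (1 - (t - n%:R)) + (m%:R - (n%:R + 1)) + (s - m%:R) by ring.
apply: le_trans (ler_normD _ _) _; rewrite lerD//; last first.
  by rewrite normrM ger0_norm ?ler_piMr ?ler_norml; lra.
apply: le_trans (ler_normD _ _) _; rewrite lerD//.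
by rewrite normrM ger0_norm ?ler_piMr ?ler_norml; lra.
Qed.

Lemma steady_convex f1 f2 t : 0 <= t <= 1 -> steady f1 -> steady f2 ->
  steady (fun x => (1 - t) * f1 x + t * f2 x).
Proof.
move=> /andP[t0 t1] sf1 sf2 e e0.
have cvx x y : `|f1 x - f1 y| <= e -> `|f2 x - f2 y| <= e ->
    `|(1 - t) * f1 x + t * f2 x - ((1 - t) * f1 y + t * f2 y)| <= e.
  move=> h1 h2; rewrite [X in `|X|](_ : _ =
    (1 - t) * (f1 x - f1 y) + t * (f2 x - f2 y)); last by ring.
  apply: le_trans (ler_normD _ _) _; rewrite !normrM (ger0_norm t0).
  rewrite (ger0_norm (_ : 0 <= 1 - t)) ?subr_ge0//.
  have -> : e = (1 - t) * e + t * e by ring.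
  by rewrite lerD// ler_wpM2l// subr_ge0.
have [h1 [N1 k1]] := sf1 e e0; have [h2 [N2 k2]] := sf2 e e0.
split=> [r|].
  have [M1 hM1] := h1 r; have [M2 hM2] := h2 r.
  exists (Num.max M1 M2) => x y; rewrite gt_max => /andP[xM1 xM2] xy.
  by apply: cvx; [exact: hM1|exact: hM2].
exists (maxn N1 N2) => n; rewrite geq_max => /andP[n1 n2] x.
by apply: cvx; [exact: k1|exact: k2].
Qed.

Lemma exists_contracting_weights :
  exists L A g, contracting_weights L A g.
Proof.
have [L L0 [F [G [G0 Gsupp Gsum Gst [F0 Gid]]]]] := steady_weights.
have [s s0 Hs] := combing_control 1.
have trunc_itv (t : R) : 0 <= t -> 0 <= t - (Num.truncn t)%:R <= 1.
  by move=> /truncn_itv/andP[]; rewrite -natr1; lra.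
have supp2 (t : R) x a : 0 <= t -> interpolate (fun n => G n x a) t != 0 ->
    G (Num.truncn t) x a != 0 \/ G (Num.truncn t).+1 x a != 0.
  move=> _; rewrite /interpolate.
  have [->|] := eqVneq (G (Num.truncn t) x a) 0; last by left.
  have [->|] := eqVneq (G (Num.truncn t).+1 x a) 0; last by right.
  by rewrite !mulr0 addr0 eqxx.
have G01 n x a : 0 <= G n x a <= 1.
  rewrite G0/=; have [->|/Gsupp[Fa _]] := eqVneq (G n x a) 0; first exact: ler01.
  by rewrite -(Gsum n x) (big_fsetD1 a)//= lerDl sumr_ge0.
have sumB n (B : {fset X}) x : (F n `<=` B)%fset -> \sum_(a <- B) G n x a = 1.
  move=> FB; rewrite -(Gsum n x) [RHS](big_fset_incl _ FB)// => a _ Fa.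
  by apply/eqP; apply: contraNT Fa => /Gsupp[].
exists (s + L), (fun t => F (Num.truncn t) `|` F (Num.truncn t).+1)%fset,
  (fun t x a => interpolate (fun n => G n x a) t).
split.
- move=> t x a /trunc_itv/andP[h0 h1].
  by rewrite addr_ge0// mulr_ge0// subr_ge0.
- by move=> t x a t0 /(supp2 _ _ _ t0)[] /Gsupp[Fa _]; rewrite inE Fa ?orbT.
- move=> t x a t0 /(supp2 _ _ _ t0)[] /Gsupp[_ xa].
    by rewrite (le_trans xa)// lerDr.
  apply: le_trans (metric_triangle _ (H x (Num.truncn t).+1) _) _.
  rewrite lerD// Hs ?mdistxx// -natr1 opprD addrA subrr sub0r normrN.
  by rewrite normr1.
- move=> t x t0; rewrite big_split/= -!mulr_sumr !sumB ?fsubsetUl ?fsubsetUr//.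
  by rewrite !mulr1 subrK.
- by move=> t a /trunc_itv t01; exact: steady_convex.
- by move=> t u x a t0 u0; exact: interpolate_lip.
- move=> x a; rewrite /interpolate truncn0 subrr mul0r addr0 subr0 mul1r.
  have -> : G 0%N x a = (a == x0)%:R; last by [].
  have [->|ax] := eqVneq a x0; last first.
    by apply/eqP; apply: contraNT ax => /Gsupp[]; rewrite F0 inE.
  by have := Gsum 0%N x; rewrite F0 big_seq_fset1.
- move=> M; have [N hN] := Gid M; exists N%:R => t x a Nt xM.
  have t0 : 0 <= t := le_trans (ler0n _ N) Nt.
  have NT : (N <= Num.truncn t)%N by rewrite truncn_ge_nat.
  by rewrite /interpolate !hN ?(leqW NT)// -mulrDl subrK mul1r.
move=> T; exists (\bigcup_(n <- iota 0 (Num.truncn T).+2) F n)%fset => t t0 tT.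
have tT' : (Num.truncn t <= Num.truncn T)%N by exact: le_truncn.
by rewrite fsubUset !bigfcup_sup ?mem_iota//= ltnS ?ltnS ?(leqW tT').
Qed.

End combing_facts.

(** * Rips complexes *)

Section barycentric.
Context (R : realType) (X : metricType R).
Implicit Types (r s : {nonneg R}) (A B : {fset X}) (x y a : X).

Lemma bary_ge0 r (u : rips X r) x : 0 <= u x.
Proof. by have [+ _ _] := baryP u; exact. Qed.

Lemma bary_sum r (u : rips X r) : \sum_(x <- finsupp u) u x = 1.
Proof. by have [_ + _] := baryP u. Qed.

Lemma bary_simplex r (u : rips X r) : is_simplex r%:num (finsupp u).
Proof. by have [_ _ +] := baryP u. Qed.

Lemma bary_le1 r (u : rips X r) x : u x <= 1.
Proof.
have [xu|] := boolP (x \in finsupp u); last first.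
  by move=> /fsfun_dflt ->; exact: ler01.
rewrite -(bary_sum u) (big_fsetD1 x)//= lerDl sumr_ge0// => y _.
exact: bary_ge0.
Qed.

Lemma bary_incl r (u : rips X r) B (F : X -> R) : (finsupp u `<=` B)%fset ->
  \sum_(x <- B) u x * F x = \sum_(x <- finsupp u) u x * F x.
Proof.
move=> uB; rewrite [RHS](big_fset_incl _ uB)// => x _ /fsfun_dflt ->.
by rewrite mul0r.
Qed.

Lemma bary_average r (u : rips X r) (F : X -> R) c e :
  (forall x, x \in finsupp u -> `|F x - c| <= e) ->
  `|\sum_(x <- finsupp u) u x * F x - c| <= e.
Proof.
move=> Fc.
have -> : c = \sum_(x <- finsupp u) u x * c by rewrite -mulr_suml bary_sum mul1r.
rewrite -sumrB; apply: le_trans (ler_norm_sum _ _ _) _.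
have -> : e = \sum_(x <- finsupp u) u x * e by rewrite -mulr_suml bary_sum mul1r.
rewrite big_seq [leRHS]big_seq; apply: ler_sum => x xu.
rewrite -mulrBr normrM ger0_norm ?bary_ge0// ler_wpM2l ?bary_ge0//.
exact: Fc.
Qed.

Definition bary_push A (g : X -> X -> R) (u : {fsfun X -> R with 0}) :
    {fsfun X -> R with 0} :=
  [fsfun a in A => \sum_(x <- finsupp u) u x * g x a | 0].

Definition stochastic A (g : X -> X -> R) : Prop :=
  [/\ forall x a, 0 <= g x a, forall x a, g x a != 0 -> a \in A
    & forall x, \sum_(a <- A) g x a = 1].

Section bary_push.
Context (A : {fset X}) (g : X -> X -> R).
Hypothesis gA : stochastic A g.

Lemma bary_pushE u a :
  bary_push A g u a = \sum_(x <- finsupp u) u x * g x a.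
Proof.
have [_ supp _] := gA; rewrite fsfunE; case: ifPn => // aA.
rewrite big1// => x _; apply/eqP; rewrite mulf_eq0 orbC.
by have [//|/supp aA'] := eqVneq (g x a) 0; rewrite aA' in aA.
Qed.

Lemma finsupp_bary_push u : (finsupp (bary_push A g u) `<=` A)%fset.
Proof.
apply/fsubsetP => a; rewrite mem_finsupp fsfunE.
by case: ifP => //; rewrite eqxx.
Qed.

Lemma finsupp_bary_push_ex u a : a \in finsupp (bary_push A g u) ->
  exists2 x, x \in finsupp u & g x a != 0.
Proof.
rewrite mem_finsupp bary_pushE => h; apply/not_exists2P => no.
move: h; rewrite big_seq big1 ?eqxx// => x xu.
by have [//|/negP/negPn/eqP ->] := no x; rewrite mulr0.
Qed.

Lemma bary_push_point r s (u : rips X r) :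
  (forall x y a b, mdist x y <= r%:num -> g x a != 0 -> g y b != 0 ->
    mdist a b <= s%:num) ->
  is_rips_point s%:num (bary_push A g u).
Proof.
move=> gs; have [g0 supp g1] := gA; split.
- move=> a; rewrite bary_pushE; apply: sumr_ge0 => x _.
  by rewrite mulr_ge0// bary_ge0.
- rewrite (big_fset_incl _ (finsupp_bary_push u))//; last first.
    by move=> a _ /fsfun_dflt.
  rewrite (eq_bigr _ (fun a _ => bary_pushE u a)) exchange_big/=.
  rewrite -[RHS](bary_sum u); apply: eq_bigr => x _.
  by rewrite -mulr_sumr g1 mulr1.
split.
  apply/negP => /eqP s0.
  have : \sum_(a <- A) bary_push A g u a = 1.
    rewrite (eq_bigr _ (fun a _ => bary_pushE u a)) exchange_big/=.
    rewrite -[RHS](bary_sum u); apply: eq_bigr => x _.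
    by rewrite -mulr_sumr g1 mulr1.
  rewrite big1 => [/eqP|a _]; first by rewrite eq_sym oner_eq0.
  by apply: fsfun_dflt; rewrite s0 inE.
move=> a b /finsupp_bary_push_ex[x xu xa] /finsupp_bary_push_ex[y yu yb].
by apply: gs xa yb; exact: (bary_simplex u).2.
Qed.

End bary_push.

End barycentric.

Section complex_limits.
Context (R : realType).

Lemma cplx_cvgP (T : Type) (F : set_system T) {FF : Filter F}
    (f : T -> Cplx R) (l : Cplx R) :
  f @ F --> l <->
  forall e : R, 0 < e -> F [set x | modulus (f x - l) < e].
Proof.
split=> [/cvgrPdist_lt h e e0|h].
  have /h : (0 < e%:C :> R[i])%C by rewrite ltcR.
  apply: filterS => x /=; rewrite distrC normc_def ltcR.
  by rewrite /modulus; case: (f x - l).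
apply/cvgrPdist_lt => e; case: e => a b; rewrite ltcE/= => /andP[/eqP -> a0].
apply: filterS (h a a0) => x /=; rewrite distrC normc_def ltcR.
by rewrite /modulus; case: (f x - l).
Qed.

Lemma cplx_continuousP (T : topologicalType) (f : T -> Cplx R) :
  continuous f <->
  forall x (e : R), 0 < e -> \forall y \near x, modulus (f y - f x) < e.
Proof.
split=> [cf x|h x]; first exact: (iffLR (cplx_cvgP _ _) (cf x)).
exact: (iffRL (cplx_cvgP _ _) (h x)).
Qed.

Lemma cplx_nbhs (z : Cplx R) (B : set (Cplx R)) : nbhs z B ->
  exists2 e : R, 0 < e & forall w, modulus (w - z) < e -> B w.
Proof.
move=> /nbhs_normP[[a b]]; rewrite /= ltcE/= => /andP[/eqP -> a0] aB.
exists a => // w wz; apply: aB; rewrite /ball_/= distrC normc_def ltcR.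
by move: wz; rewrite /modulus; case: (w - z).
Qed.

End complex_limits.

Section rips_topology.
Context (R : realType) (X : metricType R) (s : {nonneg R}).
Implicit Types (A t : {fset X}) (u v : rips X s).

Lemma bary_continuous x : continuous (fun u : rips X s => bary u x).
Proof.
apply/continuousP => B oB.
change (rips_open ((fun u : rips X s => bary u x) @^-1` B)) => t ts.
exists ((fun w : {ptws X -> R} => w x) @^-1` B) => //.
by move: B oB; apply/continuousP; exact: (@proj_continuous X (fun=> R) x).
Qed.

Lemma fmap_ultra (T U : Type) (F : set_system T) (f : T -> U) :
  UltraFilter F -> UltraFilter (f @ F).
Proof.
move=> UF; have PF : ProperFilter F by exact: ultra_proper.
split=> [|G PG FG]; first exact: fmap_proper_filter.
apply/seteqP; split=> // A GA.
have [//|nA] := in_ultra_setVsetC (f @^-1` A) UF.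
have : G (A `&` ~` A) by apply: filterI => //; exact: FG.
by rewrite setICr => /filter_not_empty.
Qed.

Lemma cvg_sum_seq (T I : Type) (F : set_system T) {FF : Filter F} (r : seq I)
    (f : I -> T -> R) (l : I -> R) :
  (forall i, f i @ F --> l i) ->
  (fun x => \sum_(i <- r) f i x) @ F --> \sum_(i <- r) l i.
Proof.
move=> fl; elim: r => [|i r IH].
  by under eq_fun do rewrite big_nil; rewrite big_nil; exact: cvg_cst.
by under eq_fun do rewrite big_cons; rewrite big_cons; exact: cvgD.
Qed.

Lemma rips_cvg (U : set_system (rips X s)) {UU : Filter U} t v :
  is_simplex s%:num t -> face t v -> U (face t) ->
  (forall x, (fun u => u x) @ U --> v x) -> U --> v.
Proof.
move=> ts tv Ut cv B; rewrite nbhsE => -[Q [oQ Qv] QB].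
apply: filterS QB _; have [V oV QV] := (oQ : rips_open Q) t ts.
have cU : {ptws, (fun u : rips X s => (bary u : X -> R)) @ U -->
    (bary v : X -> R)} by apply/pointwise_cvgP.
have : nbhs (bary v : {ptws X -> R}) V.
  by apply: open_nbhs_nbhs; split=> //; exact/(QV v tv).
move=> /cU UV; have {}UV : U (fun u => V (bary u : X -> R)) by [].
apply: filterS2 Ut UV => u tu Vu; exact/(QV u tu).
Qed.

(* [A] itself need not be a simplex. *)
Lemma compact_cell A : compact [set u : rips X s | (finsupp u `<=` A)%fset].
Proof.
rewrite compact_ultra => U UU UA.
have PU : ProperFilter U by exact: ultra_proper.
have /choice[w wP] x : exists c : R, (fun u : rips X s => u x) @ U --> c.
  have U01 : U [set u : rips X s | u x \in `[0, 1]].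
    apply: filterS filterT => u _ /=.
    by rewrite in_itv/= bary_ge0 bary_le1.
  have := @segment_compact R 0 1; rewrite compact_ultra.
  move=> /(_ _ (fmap_ultra (fun u : rips X s => u x) UU) U01)[c [_ cU]].
  by exists c.
pose t := [fset x in A | `[< U [set u | u x != 0] >]]%fset.
have Ut : U [set u | finsupp u = t].
  have UP : U (\bigcap_(x in [set` A]) [set u | (x \in finsupp u) = (x \in t)]).
    apply: filter_bigI => x xA; rewrite !inE xA/=.
    have [Ux|nUx] := asboolP (U [set u : rips X s | u x != 0]).
      by apply: filterS Ux => u /=; rewrite mem_finsupp => ->.
    have [//|] := in_ultra_setVsetC [set u : rips X s | u x != 0] UU.
    by apply: filterS => u /= /negP; rewrite mem_finsupp => /negbTE.
  apply: filterS2 UA UP => u /= uA uP; apply/fsetP => x.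
  have [xA|xA] := boolP (x \in A); first exact: uP.
  rewrite !inE (negbTE xA)/=; apply/negbTE.
  by apply: contra xA; exact: (fsubsetP uA).
have [u ut] := filter_ex Ut.
have ts : is_simplex s%:num t by rewrite -ut; exact: bary_simplex.
have w0 x : x \notin t -> w x = 0.
  move=> xt; apply: (cvg_unique (@Rhausdorff R) (wP x)).
  by apply: cvg_near_cst; apply: filterS Ut => v /= vt; rewrite fsfun_dflt ?vt.
pose W : {fsfun X -> R with 0} := [fsfun x in t => w x | 0].
have WE x : W x = w x by rewrite fsfunE; case: ifPn => // /w0.
have Wt : (finsupp W `<=` t)%fset.
  by apply/fsubsetP => x; rewrite mem_finsupp fsfunE; case: ifP; rewrite ?eqxx.
have W1 : \sum_(x <- t) W x = 1.
  rewrite (eq_bigr _ (fun x _ => WE x)).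
  have h : (fun u : rips X s => \sum_(x <- t) u x) @ U --> \sum_(x <- t) w x.
    exact: cvg_sum_seq.
  apply: (cvg_unique (@Rhausdorff R) h); apply: cvg_near_cst.
  by apply: filterS Ut => v /= vt; rewrite -vt bary_sum.
have Wpt : is_rips_point s%:num W.
  split.
  - move=> x; rewrite WE; apply: (cvgr_to_ge (wP x)).
    by apply: filterS filterT => v _ /=; exact: bary_ge0.
  - by rewrite (big_fset_incl _ Wt)// => x _ /fsfun_dflt.
  split; last by move=> x y /(fsubsetP Wt) xt /(fsubsetP Wt); exact: ts.2.
  apply/negP => /eqP W0; move: W1; rewrite big1 => [/eqP|x _].
    by rewrite eq_sym oner_eq0.
  by apply: fsfun_dflt; rewrite W0 inE.
exists (RipsPoint Wpt); split.
  by apply: fsubset_trans Wt _; apply/fsubsetP => x; rewrite !inE => /andP[].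
apply: (rips_cvg ts) => //.
  by apply: filterS Ut => v /= vt; rewrite /face/= vt fsubset_refl.
by move=> x; rewrite /= WE.
Qed.

Lemma rips_uniform_continuity (f : rips X s -> Cplx R) A e :
  continuous f -> 0 < e -> exists2 d : R, 0 < d & forall u v,
    (finsupp u `<=` A)%fset -> (finsupp v `<=` A)%fset ->
    (forall a, a \in A -> `|u a - v a| <= d) -> modulus (f u - f v) < e.
Proof.
move=> cf e0; apply: contrapT => no.
pose bad (d : R) := [set uv : rips X s * rips X s |
  [/\ (finsupp uv.1 `<=` A)%fset, (finsupp uv.2 `<=` A)%fset,
    forall a, a \in A -> `|uv.1 a - uv.2 a| <= d
  & e <= modulus (f uv.1 - f uv.2)]].
pose F := filter_from [set d : R | 0 < d] bad.
have FP : ProperFilter F.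
  apply: filter_from_proper; first apply: filter_from_filter.
  - by exists 1 => /=.
  - move=> i j i0 j0; exists (Num.min i j) => /=; first by rewrite lt_min i0.
    move=> uv [? ? h ?]; split; split=> // a aA;
      by have := h a aA; rewrite le_min => /andP[].
  move=> d d0; apply: contrapT => nbad; apply: no; exists d => // u v uA vA uv.
  by rewrite ltNge; apply/negP => uve; apply: nbad; exists (u, v).
have [U [UU FU]] := ultraFilterLemma FP.
have PU : ProperFilter U by exact: ultra_proper.
have Ubad d : 0 < d -> U (bad d) by move=> d0; apply: FU; exists d.
have := @compact_cell A; rewrite compact_ultra => cA.
have UA1 : U [set uv | (finsupp (bary uv.1) `<=` A)%fset].
  by apply: filterS (Ubad 1 ltr01) => uv [].
have UA2 : U [set uv | (finsupp (bary uv.2) `<=` A)%fset].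
  by apply: filterS (Ubad 1 ltr01) => uv [].
have [u [uA Uu]] := cA _ (fmap_ultra fst UU) UA1.
have [v [vA Uv]] := cA _ (fmap_ultra snd UU) UA2.
have Uu1 : (fun uv => uv.1) @ U --> u by [].
have Uv1 : (fun uv => uv.2) @ U --> v by [].
have uv : u = v.
  apply: rips_eq; apply/fsfunP => x.
  have [xA|xA] := boolP (x \in A); last first.
    by rewrite !fsfun_dflt//; apply: contra xA; exact: fsubsetP.
  have cux : (fun uv : rips X s * rips X s => bary uv.1 x) @ U --> bary u x.
    exact: (cvg_comp _ _ Uu1 (@bary_continuous x u)).
  have cvx : (fun uv : rips X s * rips X s => bary uv.2 x) @ U --> bary v x.
    exact: (cvg_comp _ _ Uv1 (@bary_continuous x v)).
  have cuv : (fun uv : rips X s * rips X s => `|bary uv.1 x - bary uv.2 x|) @ U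
      --> `|bary u x - bary v x| by exact: cvg_norm (cvgB cux cvx).
  apply/eqP; rewrite -subr_eq0 -normr_le0; apply/ler_addgt0Pr => d d0.
  rewrite add0r; apply: (@cvgr_to_le _ U _ R _ _ d cuv).
  by apply: filterS (Ubad d d0) => -[u' v'] [_ _ h _]; exact: h.
have /cplx_cvgP h1 : (fun uv => f uv.1) @ U --> f u.
  exact: (cvg_comp _ _ Uu1 (cf u)).
have /cplx_cvgP h2 : (fun uv => f uv.2) @ U --> f u.
  by rewrite uv; exact: (cvg_comp _ _ Uv1 (cf v)).
have e20 : 0 < e / 2 by rewrite divr_gt0.
have [[u' v'] [[/= k1 k2] [_ _ _ /=]]] := @filter_ex _ U _ _
  (filterI (filterI (h1 _ e20) (h2 _ e20)) (Ubad 1 ltr01)).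
apply/negP; rewrite -ltNge.
rewrite (_ : f u' - f v' = (f u' - f u) - (f v' - f u)); last first.
  by rewrite opprB addrA subrK.
by rewrite (le_lt_trans (modulusB _ _))// (splitr e) ltrD.
Qed.

Lemma rips_continuous_simplices (f : rips X s -> Cplx R) :
  (forall t u e, is_simplex s%:num t -> face t u -> 0 < e ->
    exists2 d : R, 0 < d & forall v, face t v ->
      (forall x, x \in t -> `|v x - u x| < d) -> modulus (f v - f u) < e) ->
  continuous f.
Proof.
move=> hf; apply/continuousP => B oB.
change (rips_open (f @^-1` B)) => t ts.
pose V := \bigcup_(V' in [set V' : set {ptws X -> R} | open V' /\
  forall u : rips X s, face t u -> V' (bary u : X -> R) -> B (f u)]) V'.
exists V => [|u tu]; first by apply: bigcup_open => V' [].
split=> [Bfu|[V' [_ h] V'u]]; last exact: h.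
have [e e0 eB] := cplx_nbhs (open_nbhs_nbhs (conj oB Bfu)).
have [d d0 hd] := hf t u e ts tu e0.
exists (\bigcap_(x in [set` t])
  ((fun w : {ptws X -> R} => w x) @^-1` ball (bary u x) d)).
  split=> [|v tv h]; last first.
    by apply/eB/hd => // x xt; rewrite distrC; exact: (h x xt).
  rewrite bigcap_seq; elim/big_ind: _ => [||x _]; first exact: openT.
    by move=> ? ?; exact: openI.
  apply: (iffLR (continuousP (fun w : {ptws X -> R} => w x))).
    exact: (@proj_continuous X (fun=> R) x).
  exact: ball_open.
by move=> x _; exact: ballxx.
Qed.
End rips_topology.

(** * Functions on Rips complexes and their characters *)

Section rips_functions.
Context (R : realType) (X : metricType R) (x0 : X) (H : X -> nat -> X).
Implicit Types (r s : {nonneg R}) (x y a : X).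
Local Notation nrm x := (mdist x0 x).

Lemma modulus_distC (a b : Cplx R) : modulus (a - b) = modulus (b - a).
Proof. by rewrite -opprB modulusN. Qed.

Lemma rips_proj_near s (q : rips_proj X s) (u : rips X s) x :
  x \in finsupp u -> mdist (q u) x <= s%:num.
Proof.
move=> xu; have [t [ts tu qt]] := rips_projP q u.
by apply: ts.2 => //; exact: (fsubsetP tu).
Qed.

Lemma finsupp_ex s (u : rips X s) : exists x, x \in finsupp u.
Proof. by have [/fset0Pn[x xu] _] := bary_simplex u; exists x. Qed.

Lemma at_infinityP (P : set X) :
  at_infinity id P <-> exists N : R, forall x, N < nrm x -> P x.
Proof.
split=> [[B /(boundedP x0)[N BN] BP]|[N NP]].
  by exists N => x Nx; apply: BP => /BN; rewrite leNgt Nx.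
exists [set x | nrm x <= N]; first by apply/(boundedP x0); exists N.
by move=> x /= /negP; rewrite -ltNge => /NP.
Qed.

Lemma combing_funP (f : X -> Cplx R) :
  combing_fun H f <-> [/\ bounded_function f,
    forall r e : R, 0 < e -> exists N : R, forall x y, N < nrm x ->
      mdist x y <= r -> modulus (f x - f y) < e
  & forall e : R, 0 < e -> exists N : nat, forall n x, (N <= n)%N ->
      modulus (f (H x n) - f x) < e].
Proof.
split=> [/combing_funE[bf vf hf]|[bf vf hf]].
  split=> // [r e e0|e e0].
    have r0 : 0 < Num.max r 1 by rewrite lt_max ltr01 orbT.
    have [N hN] := iffLR (at_infinityP _)
      (iffLR (oscillation_cvg0P _ bf) (vf _ r0) e e0).
    exists N => x y Nx xy; rewrite modulus_distC; apply: (hN x) => //.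
    by split=> //=; rewrite le_max xy.
  have [N _ hN] := (oscillation_cvg0P _ bf).1 hf e e0.
  by exists N => n x Nn; exact: (hN n Nn (H x n) x).
apply/combing_funE; split=> // [r r0|].
  apply/(oscillation_cvg0P _ bf) => e e0; have [N hN] := vf r e e0.
  apply/at_infinityP; exists N => x Nx y w [/= yx wx]; rewrite wx in yx *.
  by rewrite modulus_distC; exact: hN.
apply/(oscillation_cvg0P _ bf) => e e0; have [N hN] := hf e e0.
by exists N => // n Nn _ x /= ->; exact: hN.
Qed.

(* The choice of the projection [q] is immaterial. *)
Lemma rips_funP s (q : rips_proj X s) (f : rips X s -> Cplx R) :
  rips_fun H q f <-> [/\ bounded_function f, continuous f,
    forall M e : R, 0 < e -> exists N : R, forall u v x y,
      x \in finsupp (bary u) -> y \in finsupp (bary v) -> N < nrm x ->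
      mdist x y <= M -> modulus (f u - f v) < e
  & forall e : R, 0 < e -> exists N : nat, forall n x, (N <= n)%N ->
      modulus (f (vertex s (H x n)) - f (vertex s x)) < e].
Proof.
split=> [[bf cf vf /combing_funP[_ _ hf]]|[bf cf vf hf]].
  split=> // M e e0.
  pose E := [set uv : rips X s * rips X s |
    mdist (q uv.1) (q uv.2) <= s%:num + M + s%:num].
  have /vf : coarse_entourage q E by exists (s%:num + M + s%:num).
  rewrite variationE => /(oscillation_cvg0P _ bf)/(_ e e0)[B [C BC] hB].
  have [M' hM'] : exists M', forall u, B u -> nrm (q u) <= M'.
    have [->|/set0P[b Bb]] := eqVneq B set0; first by exists 0.
    exists (nrm (q b) + C) => u Bu.
    by apply: le_trans (metric_triangle _ (q b) _) _; rewrite lerD2l BC.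
  exists (M' + s%:num) => u v x y xu yv Mx xy.
  have qx := rips_proj_near q xu; have qy := rips_proj_near q yv.
  rewrite modulus_distC; apply: (hB u).
    move=> /hM'; have := metric_triangle x0 (q u) x; lra.
  split=> //; rewrite /E/= metric_sym.
  apply: le_trans (metric_triangle _ y _) _; rewrite lerD//; last first.
    by rewrite metric_sym.
  by apply: le_trans (metric_triangle _ x _) _; rewrite lerD.
split=> // [E [M EM]|].
  rewrite variationE; apply/(oscillation_cvg0P _ bf) => e e0.
  have [N hN] := vf (s%:num + M + s%:num) e e0.
  exists [set u | nrm (q u) <= N + s%:num].
    exists (N + s%:num + (N + s%:num)) => u v /= uN vN.
    apply: le_trans (metric_triangle _ x0 _) _.
    by rewrite lerD// metric_sym.
  move=> u /= /negP; rewrite -ltNge => Nu v w [Evu /= wu]; rewrite wu in Evu *.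
  have [x xu] := finsupp_ex u; have [y yv] := finsupp_ex v.
  have qx := rips_proj_near q xu; have qy := rips_proj_near q yv.
  rewrite modulus_distC; apply: (hN _ _ x y) => //.
    by have := metric_triangle x0 x (q u); rewrite (metric_sym x); lra.
  apply: le_trans (metric_triangle _ (q v) _) _; rewrite lerD//.
  apply: le_trans (metric_triangle _ (q u) _) _; rewrite lerD//.
    by rewrite metric_sym.
  by rewrite metric_sym; exact: EM Evu.
apply/combing_funP; split=> // [|r e e0].
  by have [M hM] := bf; exists M => x; exact: hM.
have [N hN] := vf r e e0; exists N => x y Nx xy.
by apply: (hN _ _ x y) => //; rewrite finsupp_vertex inE.
Qed.

Lemma modulusV (z : Cplx R) : modulus z^-1 = (modulus z)^-1.
Proof. exact: ComplexField.Normc.normcV. Qed.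

Lemma modulus_gt0 (z : Cplx R) : 0 < modulus z -> z != 0.
Proof. by apply: contraTneq => ->; rewrite modulus0 ltxx. Qed.

Lemma rips_funV s (q : rips_proj X s) (f : rips X s -> Cplx R) (d : R) :
  0 < d -> (forall u, d <= modulus (f u)) -> rips_fun H q f ->
  rips_fun H q (fun u => (f u)^-1).
Proof.
move=> d0 df /rips_funP[bf cf vf hf].
have f0 u : f u != 0 by apply: modulus_gt0; exact: lt_le_trans (df u).
have key u v e : modulus (f u - f v) < e * (d * d) ->
    modulus ((f u)^-1 - (f v)^-1) < e.
  move=> h; rewrite (_ : _ - _ = (f v - f u) * (f u)^-1 * (f v)^-1); last first.
    by rewrite mulrBl mulfV// mulrBl mul1r mulrAC mulfV// mul1r.
  rewrite !modulusM !modulusV modulus_distC.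
  rewrite -mulrA -invfM ltr_pdivrMr; last first.
    by rewrite mulr_gt0//; exact: lt_le_trans (df _).
  have e0 : 0 < e.
    by have := le_lt_trans (modulus_ge0 _) h; rewrite pmulr_lgt0// mulr_gt0.
  apply: lt_le_trans h _; rewrite ler_wpM2l ?(ltW e0)// ler_pM ?(ltW d0)//.
have dd : 0 < d * d by rewrite mulr_gt0.
apply/rips_funP; split.
- exists d^-1 => u; rewrite modulusV lef_pV2 ?posrE//.
  exact: lt_le_trans (df u).
- apply/cplx_continuousP => u e e0.
  have h := iffLR (cplx_continuousP f) cf u _ (mulr_gt0 e0 dd).
  by apply: filterS h => v; exact: key.
- move=> M e e0; have [|N hN] := vf M (e * (d * d)); first by rewrite mulr_gt0.
  by exists N => u v x y *; apply: key; exact: (hN u v x y).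
- move=> e e0; have [|N hN] := hf (e * (d * d)); first by rewrite mulr_gt0.
  by exists N => n x Nn; apply: key; exact: hN.
Qed.

Section characters.
Context s (q : rips_proj X s) (chi : rips_compactification H q).
Implicit Types f g : DP H q.

Lemma character_linear (c : Cplx R) f g :
  val chi (c *: f + g) = c * val chi f + val chi g.
Proof. by have [+ _] : is_character (val chi) := set_mem (valP chi); exact. Qed.

Lemma characterM f g : val chi (f * g) = val chi f * val chi g.
Proof.
by have [_ [_ +]] : is_character (val chi) := set_mem (valP chi); exact.
Qed.

Lemma character1 : val chi (1 : DP H q) = 1.
Proof. by have [_ []] : is_character (val chi) := set_mem (valP chi). Qed.

Lemma characterB f g : val chi (f - g) = val chi f - val chi g.
Proof.
by rewrite -scaleN1r addrC character_linear mulN1r addrC.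
Qed.

Lemma DP_fun f : rips_fun H q (val f).
Proof. exact/asboolP/(valP f). Qed.

(* Characters are contractive: otherwise [chi f - f] would be bounded away from
   [0], hence invertible, in the kernel of [chi]. *)
Lemma character_bound f (M : R) :
  (forall u, modulus (val f u) <= M) -> modulus (val chi f) <= M.
Proof.
move=> fM; rewrite leNgt; apply/negP => Mc.
pose c : Cplx R := val chi f; pose g : DP H q := c *: (1 : DP H q) - f.
have cg : val chi g = 0.
  by rewrite characterB -[c *: _]addr0 character_linear character1 mulr1
    -(subrr 1) characterB subrr addr0 subrr.
have dg u : modulus c - M <= modulus (val g u).
  rewrite (_ : val g u = c - val f u :> Cplx R); last first.
    by rewrite /g /=; congr (_ - _); exact: mulr1.
  have := modulusD (c - val f u : Cplx R) (val f u).
  by rewrite subrK; have := fM u; lra.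
have d0 : 0 < modulus c - M by rewrite subr_gt0.
have gV := rips_funV d0 dg (DP_fun g).
pose h : DP H q := exist _ (fun u => (val g u)^-1) (introT (asboolP _) gV).
have : g * h = 1.
  apply: val_inj; apply/funext => u; apply: mulfV.
  by apply: modulus_gt0; exact: lt_le_trans (dg u).
by move=> /(congr1 (val chi)); rewrite characterM cg mul0r character1 => /eqP;
  rewrite eq_sym oner_eq0.
Qed.

End characters.

Section push_functions.
Variables (r s : {nonneg R}) (A : {fset X}) (g : X -> X -> R).
Variable phi : rips X r -> rips X s.
Hypothesis gA : stochastic A g.
Hypothesis phiE : forall u, bary (phi u) = bary_push A g (bary u).

Lemma finsupp_push u : (finsupp (phi u) `<=` A)%fset.
Proof. by rewrite phiE; exact: finsupp_bary_push. Qed.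

Lemma push_dist (u v : rips X r) a e :
  (forall x y, x \in finsupp u -> y \in finsupp v -> `|g x a - g y a| <= e) ->
  `|phi u a - phi v a| <= e.
Proof.
move=> h; rewrite !phiE !bary_pushE//; apply: bary_average => x xu.
by rewrite distrC; apply: bary_average => y yv; rewrite distrC; exact: h.
Qed.

Lemma push_continuous (f : rips X s -> Cplx R) :
  continuous f -> continuous (f \o phi).
Proof.
move=> cf; apply: rips_continuous_simplices => t u e ts tu e0.
have [d d0 hd] := rips_uniform_continuity A cf e0.
have t0 : 0 < 1 + (size t)%:R :> R by rewrite ltr_wpDr.
exists (d / (1 + (size t)%:R)); first by rewrite divr_gt0.
move=> v tv uv; apply: hd => [||a _]; rewrite ?finsupp_push//.
rewrite !phiE !bary_pushE// -(bary_incl _ tu) -(bary_incl _ tv) -sumrB.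
apply: le_trans (ler_norm_sum _ _ _) _.
apply: (@le_trans _ _ (\sum_(x <- t) d / (1 + (size t)%:R))).
  rewrite big_seq [leRHS]big_seq; apply: ler_sum => x xt.
  rewrite -mulrBl normrM -[leRHS]mulr1 ler_pM//; first exact/ltW/uv.
  have [g0 supp g1] := gA; rewrite ger0_norm//.
  have [->|/supp aA] := eqVneq (g x a) 0; first exact: ler01.
  by rewrite -(g1 x) (big_fsetD1 a)//= lerDl sumr_ge0.
rewrite big_const_seq count_predT iter_addr_0 -[leLHS]mulr_natr mulrAC.
rewrite ler_pdivrMr//.
by rewrite ler_wpM2l ?(ltW d0)// lerDr.
Qed.

Lemma push_rips_fun (p : rips_proj X r) (q : rips_proj X s) f :
  (forall a, steady x0 H (g ^~ a)) ->
  rips_fun H q f -> rips_fun H p (f \o phi).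
Proof.
move=> sg /(rips_funP q)[bf cf vf hf]; apply/(rips_funP p); split.
- by have [M hM] := bf; exists M => u; exact: hM.
- exact: push_continuous.
- move=> M e e0; have [d d0 hd] := rips_uniform_continuity A cf e0.
  have [h _] := @defect_seq _ _ x0 H A (fun a x => g x a) d (fun a _ => sg a d d0).
  have [N hN] := h (r%:num + M + r%:num).
  exists (N + r%:num) => u v x y xu yv Nx xy.
  apply: hd => [||a aA]; rewrite ?finsupp_push//.
  apply: push_dist => x' y' x'u y'v.
  have xx' := (bary_simplex u).2 x x' xu x'u.
  have yy' := (bary_simplex v).2 y y' yv y'v.
  apply: hN aA.
    by have := metric_triangle x0 x' x; rewrite (metric_sym x'); lra.
  apply: le_trans (metric_triangle _ y _) _; rewrite lerD//.
  apply: le_trans (metric_triangle _ x _) _; rewrite lerD//.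
  by rewrite metric_sym.
- move=> e e0; have [d d0 hd] := rips_uniform_continuity A cf e0.
  have [_ [N hN]] :=
    @defect_seq _ _ x0 H A (fun a x => g x a) d (fun a _ => sg a d d0).
  exists N => n x Nn; apply: hd => [||a aA]; rewrite ?finsupp_push//.
  apply: push_dist => x' y'.
  by rewrite !finsupp_vertex !inE => /eqP -> /eqP ->; exact: hN.
Qed.

End push_functions.

Section norm_estimates.
Hypothesis H_combing : is_combing x0 H.
Hypothesis H_coherent : coherent H.
Variables (L : R) (A : R -> {fset X}) (g : R -> X -> X -> R).
Hypothesis gA : contracting_weights x0 H L A g.
Variables (r s : {nonneg R}) (rs : r%:num <= s%:num).
Variable phi : R -> rips X r -> rips X s.
Hypothesis phiE : forall t u, 0 <= t ->
  bary (phi t u) = bary_push (A t) (g t) (bary u).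
Variables (q : rips_proj X s) (f : rips X s -> Cplx R).
Hypothesis ff : rips_fun H q f.

Lemma weight_stochastic t : 0 <= t -> stochastic (A t) (g t).
Proof.
move=> t0; split=> [x a|x a|x].
- exact: (weight_ge0 gA).
- exact: (weight_supp gA).
- exact: (weight_sum gA).
Qed.

Lemma push_time_continuous t e : 0 <= t -> 0 < e ->
  exists2 d : R, 0 < d & forall t', 0 <= t' -> `|t' - t| <= d ->
    forall u, modulus (f (phi t' u) - f (phi t u)) < e.
Proof.
move=> t0 e0; have [_ cf _ _] := iffLR (rips_funP q f) ff.
have [B hB] := weight_range gA (t + 1).
have [d d0 hd] := rips_uniform_continuity B cf e0.
exists (Num.min d 1); first by rewrite lt_min d0 ltr01.
move=> t' t'0; rewrite le_min => /andP[td t1] u; apply: hd => [||a _].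
- rewrite phiE//; apply: fsubset_trans (finsupp_bary_push _ _ _) (hB _ _ _) => //.
  by move: t1; rewrite ler_norml; lra.
- rewrite phiE//; apply: fsubset_trans (finsupp_bary_push _ _ _) (hB _ _ _) => //.
  by rewrite lerDl.
rewrite !phiE// !bary_pushE; [|exact: weight_stochastic..].
rewrite -sumrB -[X in `|X|]subr0.
rewrite (eq_bigr (fun x => u x * (g t' x a - g t x a))) => [|x _]; last first.
  by rewrite mulrBr.
by apply: bary_average => x _; rewrite subr0 (le_trans (weight_lip gA _ _ _ _)).
Qed.

Lemma push_to_identity e : 0 < e -> exists2 T : R, 0 <= T & forall t, T <= t ->
  forall u, modulus (f (phi t u) - f (rips_incl rs u)) < e.
Proof.
move=> e0; have e30 : 0 < e / 3 by rewrite divr_gt0.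
have [_ _ vf hf] := iffLR (rips_funP q f) ff.
have [N1 hN1] := vf 0 _ e30.
have [N2 hN2] := hf _ e30.
have [N3 hN3] := vf L _ e30.
have [N5 [N4 hN5]] := combing_proper H_combing H_coherent N3.
have [T hT] := weight_end gA (Num.max N1 N5 + r%:num).
pose T' := Num.max 0 (Num.max T (Num.max N2%:R N4%:R)).
exists T'; first by rewrite le_max lexx.
move=> t; rewrite !ge_max => /and4P[t0 Tt N2t N4t] u.
have gt := weight_stochastic t0.
have [a at_] := finsupp_ex (phi t u).
have [x xu gxa] : exists2 x, x \in finsupp u & g t x a != 0.
  by move: at_; rewrite phiE//; exact: finsupp_bary_push_ex.
pose n := Num.truncn t.
have N2n : (N2 <= n)%N by rewrite truncn_ge_nat.
have N4n : (N4 <= n)%N by rewrite truncn_ge_nat.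
have [xN|] := leP (nrm x) (Num.max N1 N5).
  rewrite (_ : phi t u = rips_incl rs u) ?subrr ?modulus0//.
  apply: rips_eq; rewrite phiE//=; apply/fsfunP => b.
  have gb y : y \in finsupp u -> g t y b = (b == y)%:R.
    move=> yu; apply: hT => //.
    apply: le_trans (metric_triangle _ x _) _; rewrite lerD//.
    exact: (bary_simplex u).2.
  rewrite bary_pushE// (eq_big_seq (fun y => u y * (b == y)%:R)); last first.
    by move=> y yu; rewrite gb.
  have [bu|bu] := boolP (b \in finsupp u).
    rewrite (big_fsetD1 b)//= eqxx mulr1 big_seq big1 ?addr0// => y.
    by rewrite !inE eq_sym => /andP[/negbTE -> _]; rewrite mulr0.
  rewrite big_seq big1 ?fsfun_dflt// => y yu.
  by rewrite [b == y]negbTE ?mulr0//; apply: contraNneq bu => ->.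
rewrite gt_max => /andP[N1x N5x].
have Hx : N3 < nrm (H x n).
  by rewrite ltNge; apply/negP => /(hN5 _ _ N4n); rewrite leNgt N5x.
have k1 : modulus (f (vertex s x) - f (rips_incl rs u)) < e / 3.
  by apply: (hN1 _ _ x x) => //; rewrite ?finsupp_vertex ?inE ?mdistxx.
have k2 := hN2 n x N2n.
have k3 : modulus (f (vertex s (H x n)) - f (phi t u)) < e / 3.
  apply: (hN3 _ _ (H x n) a) => //; rewrite ?finsupp_vertex ?inE//.
  exact: (weight_dist gA).
rewrite modulus_distC in k3.
rewrite (_ : _ - _ = (f (phi t u) - f (vertex s (H x n))) +
  (f (vertex s (H x n)) - f (vertex s x)) +
  (f (vertex s x) - f (rips_incl rs u))); last first.
  by rewrite !addrA !subrK.
have := modulusD (f (phi t u) - f (vertex s (H x n)) +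
  (f (vertex s (H x n)) - f (vertex s x)))
  (f (vertex s x) - f (rips_incl rs u)).
have := modulusD (f (phi t u) - f (vertex s (H x n)))
  (f (vertex s (H x n)) - f (vertex s x)).
lra.
Qed.

End norm_estimates.

End rips_functions.

(** * Homotopies on a union of stages *)

Section sigma_homotopy.
Context (R : realType).

Lemma unit_interval_compact (K : set R) : compact K -> K `<=` `[0, 1] ->
  compact ((fun t : unit_interval R => \val t) @^-1` K).
Proof.
move=> cK K01; rewrite compact_ultra => U UU UK.
move: cK; rewrite compact_ultra.
move=> /(_ _ (fmap_ultra (fun t : unit_interval R => \val t) UU) UK)[c [Kc Uc]].
have c01 : c \in `[0, 1]%classic by apply/mem_set/K01.
exists (exist _ c c01 : unit_interval R); split=> //.
move=> B [_ [[V oV <-] Vc] VB]; apply: filterS VB _.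
by apply: Uc; exact: open_nbhs_nbhs.
Qed.

Lemma tube_open (Y Z : topologicalType) (T : topologicalType)
    (h : Y * T -> Z) (J : set T) (W : set Z) :
  continuous h -> compact J -> open W ->
  open [set y | forall t, J t -> W (h (y, t))].
Proof.
move=> ch /compact_near_coveringP cJ oW; rewrite openE => y yW.
have hP : \forall y' \near y, J `<=` (fun t => W (h (y', t))).
  apply: cJ => t Jt; have : nbhs (y, t) (h @^-1` W).
    by apply: ch; apply: open_nbhs_nbhs; split=> //; exact: yW.
  move=> [[P Q] [/= Py Qt] PQ]; exists (Q, P) => //= -[t' y'] /= [Qt' Py'].
  exact: (PQ (y', t')).
by apply: filterS hP => y' hy' t Jt; exact: hy'.
Qed.

Lemma unit_interval_nbhs (t : unit_interval R) (B : set (unit_interval R)) :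
  nbhs t B -> exists2 J, compact J & nbhs t J /\ J `<=` B.
Proof.
move=> [_ [[V oV <-] Vt] VB].
have /nbhs_ballP[e /= e0 eV] := open_nbhs_nbhs (conj oV Vt).
pose a := Num.max 0 (\val t - e / 2); pose b := Num.min 1 (\val t + e / 2).
exists ((fun t : unit_interval R => \val t) @^-1` `[a, b]).
  apply: unit_interval_compact; first exact: segment_compact.
  move=> x; rewrite /= !in_itv/= /a /b ge_max le_min.
  by move=> /andP[/andP[-> _] /andP[-> _]].
split.
  have vt : nbhs (\val t) (ball (\val t) (e / 2)).
    by apply: nbhsx_ballx; rewrite divr_gt0.
  have ct : nbhs t ((fun t : unit_interval R => \val t) @^-1`
      ball (\val t) (e / 2)).
    exact: (@initial_continuous _ _ (fun t : unit_interval R => \val t)).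
  apply: filterS ct => u /=; rewrite /ball/= in_itv/= /a /b ge_max le_min.
  have := set_mem (valP u); rewrite /= in_itv/= => /andP[-> ->] /=.
  by rewrite ltr_norml; lra.
move=> u /=; rewrite in_itv/= /a /b ge_max le_min.
move=> /andP[/andP[_ h1] /andP[_ h2]].
apply/VB/eV; rewrite /ball/= ltr_norml.
by change (- e < \val t - sval u < e); lra.
Qed.

Variables (Y : sigma_sequence) (Z : topologicalType).
Variable h : forall m, Y m * unit_interval R -> Z.
Hypothesis h_continuous : forall m, continuous (@h m).
Hypothesis h_transition : forall m n (mn : (m <= n)%N) y t,
  h (transition mn y, t) = h (y, t).

Definition sigma_homotopy (z : sigma_union Y * unit_interval R) : Z :=
  let y := repr (z.1 : {eq_quot stage_equiv (Y := Y)}) in h (projT2 y, z.2).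

Lemma sigma_homotopyE m (y : Y m) t : sigma_homotopy (sigma_in y, t) = h (y, t).
Proof.
rewrite /sigma_homotopy /=.
set x := repr _; have : x = existT _ m y %[mod {eq_quot stage_equiv (Y := Y)}].
  by rewrite /x reprK.
move=> /eqmodP/asboolP[k [/= xk [yk e]]].
by rewrite -(h_transition xk) e h_transition.
Qed.

Lemma sigma_unionP (z : sigma_union Y) : exists m (y : Y m), z = sigma_in y.
Proof.
exists (projT1 (repr (z : {eq_quot stage_equiv (Y := Y)}))).
exists (projT2 (repr (z : {eq_quot stage_equiv (Y := Y)}))).
by rewrite /sigma_in; case E : (repr _) => [m y] /=; rewrite -E reprK.
Qed.

Lemma sigma_openP (U : set (sigma_union Y)) :
  (forall m, open [set y : Y m | U (sigma_in y)]) -> open U.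
Proof. by move=> h'; apply/sigT_openP. Qed.

Lemma sigma_homotopy_continuous : continuous sigma_homotopy.
Proof.
apply/continuousP => W oW; rewrite openE => -[z t] Wzt.
have [m [y zy]] := sigma_unionP z; rewrite zy in Wzt *.
have Wh : W (h (y, t)) by move: Wzt; rewrite /= sigma_homotopyE.
have : nbhs (y, t) (@h m @^-1` W).
  exact: (h_continuous (open_nbhs_nbhs (conj oW Wh))).
move=> [[P Q] [/= Py Qt] PQ].
have [J cJ [Jt JQ]] := unit_interval_nbhs Qt.
exists ([set z | forall t, J t -> W (sigma_homotopy (z, t))], J) => /=.
  split=> //; apply: (@open_nbhs_nbhs (sigma_union Y)); split.
    apply: sigma_openP => n.
    rewrite (_ : [set _ | _] = [set y | forall t, J t -> W (h (y, t))]).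
      exact: (tube_open (@h_continuous n) cJ oW).
    by apply/seteqP; split=> y' H t' Jt'; have := H t' Jt';
      rewrite sigma_homotopyE.
  move=> t' Jt' /=; rewrite sigma_homotopyE; apply: (PQ (y, t')); split=> /=.
    exact: nbhs_singleton.
  exact: JQ.
by move=> [z' t'] /= [h' Jt']; exact: h'.
Qed.

End sigma_homotopy.

(** * The homotopy of the compactifications *)

Section homotopies.
Context (R : realType) (X : metricType R).
Variables (x0 : X) (H : X -> nat -> X).
Hypothesis H_combing : is_combing x0 H.
Hypothesis H_coherent : coherent H.
Variables (L : R) (A : R -> {fset X}) (g : R -> X -> X -> R).
Hypothesis gA : contracting_weights x0 H L A g.
Variable p : forall r : {nonneg R}, rips_proj X r.
Implicit Types (r s : {nonneg R}).

Local Notation I := (unit_interval R).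

Record admissible r s : Prop := Admissible {
  admissible_le : r%:num <= s%:num;
  admissible_dist : forall t x y a b, 0 <= t -> mdist x y <= r%:num ->
    g t x a != 0 -> g t y b != 0 -> mdist a b <= s%:num }.

Lemma admissible_large r : exists s0 : R, forall s, s0 <= s%:num ->
  admissible r s.
Proof.
have [C C0 hC] := combing_control H_combing r%:num.
exists (Num.max r%:num (L + C + L)) => s; rewrite ge_max => /andP[rs Cs].
split=> // t x y a b t0 xy xa yb; apply: le_trans Cs.
apply: le_trans (metric_triangle _ (H y (Num.truncn t)) _) _; rewrite lerD//.
  apply: le_trans (metric_triangle _ (H x (Num.truncn t)) _) _; rewrite lerD//.
    by rewrite metric_sym; exact: (weight_dist gA).
  by apply: hC; rewrite ?subrr ?normr0.
exact: (weight_dist gA).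
Qed.

Definition push_time (t : R) : R := Num.max 0 t.

Lemma push_time_ge0 t : 0 <= push_time t.
Proof. by rewrite le_max lexx. Qed.

Lemma push_timeE t : 0 <= t -> push_time t = t.
Proof. by move=> t0; apply/max_idPr. Qed.

Section one_stage.
Variables (r s : {nonneg R}) (rs : admissible r s).

Definition push (t : R) (u : rips X r) : rips X s :=
  RipsPoint (bary_push_point (weight_stochastic gA (push_time_ge0 t)) u
    (fun x y a b => admissible_dist rs (push_time_ge0 t))).

(* The homotopy parameter [t] in [(0, 1]] corresponds to the time
   [1 / t - 1] in [[0, +oo)] of the combing. *)
Definition slide (t : R) (u : rips X r) : rips X s :=
  if 0 < t then push (t^-1 - 1) u else rips_incl (admissible_le rs) u.

Lemma pushE t u : 0 <= t -> bary (push t u) = bary_push (A t) (g t) (bary u).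
Proof. by move=> t0 /=; rewrite push_timeE. Qed.

Lemma inv_sub1_ge0 (t : R) : 0 < t -> t <= 1 -> 0 <= t^-1 - 1.
Proof. by move=> t0 t1; rewrite subr_ge0 -[1]invr1 lef_pV2// posrE. Qed.

Lemma slide_rips_fun t f : rips_fun H (p s) f -> rips_fun H (p r) (f \o slide t).
Proof.
move=> ff; rewrite /slide; case: (0 < t); last exact: rips_fun_incl ff.
apply: (push_rips_fun (weight_stochastic gA (push_time_ge0 _)) _ _ _ ff).
  by move=> u /=.
by move=> a; apply: (weight_steady gA); exact: push_time_ge0.
Qed.

Definition slide_map (z : rips_compactification H (p r) * I) :
    rips_compactification H (p s) :=
  Defs.induced (A := DP H (p r)) (B := DP H (p s))
    (slide_rips_fun (\val z.2)) z.1.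

Lemma slide_uniform f (t0 e : R) : rips_fun H (p s) f -> 0 <= t0 <= 1 ->
  0 < e -> \forall t \near t0, 0 <= t <= 1 ->
    forall u, modulus (f (slide t u) - f (slide t0 u)) < e.
Proof.
move=> ff /andP[]; rewrite le_eqVlt => /predU1P[<- _|t0_gt0 t01] e0.
  have [T T0 hT] := push_to_identity H_combing H_coherent gA
    (admissible_le rs) (fun t u => @pushE t u) ff e0.
  have T10 : 0 < (T + 1)^-1 by rewrite invr_gt0 ltr_wpDl.
  near=> t => /andP[t_ge0 t1] u; rewrite /slide ltxx.
  case: ifPn => [t_gt0|_]; last by rewrite subrr modulus0.
  apply: hT; rewrite lerBrDr -[leLHS]invrK lef_pV2 ?posrE//.
  by apply/ltW; near: t; exact: lt_nbhsl.
have tau0 := inv_sub1_ge0 t0_gt0 t01.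
have [d d0 hd] := push_time_continuous gA (fun t u => @pushE t u) ff tau0 e0.
near=> t => /andP[_ t1] u.
have t_gt0 : 0 < t by near: t; exact: lt_nbhsr.
rewrite /slide t_gt0 t0_gt0; apply: hd; first exact: inv_sub1_ge0.
rewrite opprB addrA subrK; near: t.
have /cvgrPdist_le : GRing.inv x @[x --> t0] --> t0^-1.
  by apply: inv_continuous; rewrite gt_eqF.
by move=> /(_ d d0); apply: filterS => t; rewrite distrC.
Unshelve. all: by end_near.
Qed.

Lemma slide_map_continuous : continuous slide_map.
Proof.
apply: max_ideal_space_continuous => f; apply/cplx_continuousP => -[chi0 t0] e e0.
have e20 : 0 < e / 2 by rewrite divr_gt0.
pose F t : DP H (p r) := 
  Defs.restrict (A := DP H (p r)) (B := DP H (p s)) (slide_rips_fun t) f.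
have h1 : \forall t \near t0, forall u,
    modulus (val (F (\val t)) u - val (F (\val t0)) u) < e / 2.
  have t01 : 0 <= \val t0 <= 1.
    by have := set_mem (valP t0); rewrite /= in_itv.
  have h : \forall t \near t0, 0 <= \val t <= 1 ->
      forall u, modulus (val f (slide (\val t) u) - val f (slide (\val t0) u))
        < e / 2.
    exact: (@initial_continuous _ _ (fun t : I => \val t) t0 _
      (slide_uniform (DP_fun f) t01 e20)).
  apply: filterS h => t; apply.
  by have := set_mem (valP t); rewrite /= in_itv.
have h2 : \forall chi \near chi0,
    modulus (val chi (F (\val t0)) - val chi0 (F (\val t0))) < e / 2.
  apply: (iffLR (cplx_continuousP _)) => //.
  exact: (@max_ideal_space_eval_continuous _ _ (DP H (p r))).
exists ([set chi |
    modulus (val chi (F (\val t0)) - val chi0 (F (\val t0))) < e / 2],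
  [set t : I | forall u,
    modulus (val (F (\val t)) u - val (F (\val t0)) u) < e / 2]) => //.
move=> [chi t] /= [k2 k1].
change (modulus (val chi (F (\val t)) - val chi0 (F (\val t0))) < e).
rewrite (_ : _ - _ = val chi (F (\val t) - F (\val t0)) +
  (val chi (F (\val t0)) - val chi0 (F (\val t0)))); last first.
  by rewrite characterB addrA subrK.
rewrite (le_lt_trans (modulusD _ _))// (splitr e) ler_ltD//.
by apply: (character_bound x0) => u; exact/ltW/k1.
Qed.

Lemma slide_map0 chi t : \val t = 0 ->
  slide_map (chi, t) = compactification_incl (p r) (p s) (admissible_le rs) chi.
Proof.
move=> t0; apply: val_inj; apply/funext => f /=; congr (val chi _).
by apply: val_inj; apply/funext => u /=; rewrite /slide t0 ltxx.
Qed.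

Lemma eval_character_set u : ((fun f : DP H (p s) => val f u) :
    {ptws DP H (p s) -> Cplx R}) \in
  [set chi : {ptws DP H (p s) -> Cplx R} | is_character chi].
Proof. by apply/mem_set. Qed.

Definition eval_character u : rips_compactification H (p s) :=
  exist _ ((fun f : DP H (p s) => val f u) : {ptws DP H (p s) -> Cplx R})
    (eval_character_set u).

Lemma slide1 u : slide 1 u = vertex s x0.
Proof.
rewrite /slide ltr01 invr1 subrr; apply: rips_eq.
rewrite pushE//; apply/fsfunP => a.
rewrite bary_pushE; last exact: (weight_stochastic gA (lexx 0)).
under eq_bigr do rewrite (weight_start gA).
by rewrite -mulr_suml bary_sum mul1r fsfunE inE; case: eqP.
Qed.

Lemma slide_map1 chi t : \val t = 1 ->
  slide_map (chi, t) = eval_character (vertex s x0).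
Proof.
move=> t1; apply: val_inj; apply/funext => f /=.
transitivity (val chi (val f (vertex s x0) *: (1 : DP H (p r)))).
  congr (val chi _); apply: val_inj; apply/funext => u /=.
  by rewrite t1 slide1; apply/esym/mulr1.
by rewrite -[_ *: _]addr0 character_linear character1 mulr1
  -(subrr 1) characterB subrr addr0.
Qed.

End one_stage.

Lemma slide_map_incl r r' s s' (rs : admissible r s) (rs' : admissible r' s')
    (rr : r%:num <= r'%:num) (ss : s%:num <= s'%:num) chi t :
  compactification_incl (p s) (p s') ss (slide_map rs (chi, t)) =
  slide_map rs' (compactification_incl (p r) (p r') rr chi, t).
Proof.
apply: val_inj; apply/funext => f /=; congr (val chi _); apply: val_inj.
apply/funext => u /=; congr (val f _); rewrite /slide.
by case: ifP => _; exact: rips_eq.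
Qed.

End homotopies.

(** * The corona *)

Section affine_extension.
Context (R : realType) (X : metricType R) (x0 : X) (H : X -> nat -> X).
Implicit Types (r s : {nonneg R}) (x y a : X).
Local Notation nrm x := (mdist x0 x).

Definition cplx (c : R) : Cplx R := real_complex R c.

Lemma modulus_cplx c : modulus (cplx c) = `|c|.
Proof. by rewrite /modulus /= expr0n addr0 sqrtr_sqr. Qed.

Lemma cplx_sum (I : Type) (t : seq I) (F : I -> R) :
  \sum_(i <- t) cplx (F i) = cplx (\sum_(i <- t) F i).
Proof. by rewrite /cplx (raddf_sum (real_complex R)). Qed.

Lemma modulus_sum (I : Type) (t : seq I) (F : I -> Cplx R) :
  modulus (\sum_(i <- t) F i) <= \sum_(i <- t) modulus (F i).
Proof.
elim: t => [|i t IH]; first by rewrite !big_nil modulus0.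
by rewrite !big_cons (le_trans (modulusD _ _))// lerD2l.
Qed.

Definition affine_ext s (f : X -> Cplx R) (u : rips X s) : Cplx R :=
  \sum_(x <- finsupp u) cplx (u x) * f x.

Lemma affine_ext_incl s f (u : rips X s) (t : {fset X}) :
  (finsupp u `<=` t)%fset -> affine_ext f u = \sum_(x <- t) cplx (u x) * f x.
Proof.
move=> ut; rewrite /affine_ext (big_fset_incl _ ut)// => x _ /fsfun_dflt ->.
exact: mul0r.
Qed.

Lemma affine_ext_vertex s f x : affine_ext f (vertex s x) = f x.
Proof.
rewrite /affine_ext finsupp_vertex big_seq_fset1 fsfunE inE eqxx.
exact: mul1r.
Qed.

Lemma affine_ext_average s f (u : rips X s) (c : Cplx R) (e : R) :
  (forall x, x \in finsupp u -> modulus (f x - c) <= e) ->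
  modulus (affine_ext f u - c) <= e.
Proof.
move=> fc.
have -> : c = \sum_(x <- finsupp u) cplx (u x) * c.
  by rewrite -mulr_suml cplx_sum bary_sum; exact/esym/mul1r.
rewrite -sumrB; apply: le_trans (modulus_sum _ _) _.
have -> : e = \sum_(x <- finsupp u) u x * e by rewrite -mulr_suml bary_sum mul1r.
rewrite big_seq [leRHS]big_seq; apply: ler_sum => x xu.
rewrite -mulrBr modulusM modulus_cplx ger0_norm ?bary_ge0//.
by rewrite ler_wpM2l ?bary_ge0// fc.
Qed.

Lemma affine_ext_rips_fun s (q : rips_proj X s) f :
  combing_fun H f -> rips_fun H q (@affine_ext s f).
Proof.
move=> /(combing_funP x0)[bf vf hf]; apply/(rips_funP x0); split.
- have [M hM] := bf; exists M => u; rewrite -[affine_ext f u]subr0.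
  by apply: affine_ext_average => x _; rewrite subr0.
- have [M M0 hM] := bounded_functionP bf.
  apply: rips_continuous_simplices => t u e ts tu e0.
  have t0 : 0 < (size t)%:R * M + 1 by rewrite ltr_wpDl// mulr_ge0// ltW.
  exists (e / ((size t)%:R * M + 1)); first by rewrite divr_gt0.
  move=> v tv uv; rewrite !(affine_ext_incl _ tu) !(affine_ext_incl _ tv) -sumrB.
  apply: le_lt_trans (modulus_sum _ _) _.
  apply: (@le_lt_trans _ _
      (\sum_(x <- t) e / ((size t)%:R * M + 1) * M)).
    rewrite big_seq [leRHS]big_seq; apply: ler_sum => x xt.
    rewrite -mulrBl -raddfB modulusM modulus_cplx ler_pM ?modulus_ge0//.
    exact/ltW/uv.
  rewrite big_const_seq count_predT iter_addr_0 -[ltLHS]mulr_natr.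
  rewrite mulrAC -mulrA mulrAC ltr_pdivrMr// ltr_pM2l// mulrC ltrDl ltr01//.
- move=> M e e0; have e20 : 0 < e / 2 by rewrite divr_gt0.
  have [N hN] := vf (s%:num + M + s%:num) _ e20.
  exists (N + s%:num) => u v x y xu yv Nx xy.
  apply: (@le_lt_trans _ _ (e / 2)); last by lra.
  apply: affine_ext_average => x' x'u; rewrite modulus_distC.
  apply: affine_ext_average => y' y'v; rewrite modulus_distC.
  have xx' := (bary_simplex u).2 x x' xu x'u.
  have yy' := (bary_simplex v).2 y y' yv y'v.
  apply/ltW/hN.
    by have := metric_triangle x0 x' x; rewrite (metric_sym x'); lra.
  apply: le_trans (metric_triangle _ y _) _; rewrite lerD//.
  apply: le_trans (metric_triangle _ x _) _; rewrite lerD//.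
  by rewrite metric_sym.
- move=> e e0; have [N hN] := hf e e0; exists N => n x Nn.
  by rewrite !affine_ext_vertex; exact: hN.
Qed.

Definition indicator a x : Cplx R := (x == a)%:R.

Lemma indicator_combing_fun a :
  is_combing x0 H -> coherent H -> combing_fun H (indicator a).
Proof.
move=> Hc Hcoh; apply/(combing_funP x0); split.
- exists 1 => x; rewrite /indicator; case: eqP => _; last by rewrite modulus0.
  by rewrite (modulus_cplx 1) normr1.
- move=> r e e0; exists (nrm a + `|r|) => x y ax xy.
  have xa : (x == a) = false.
    by apply/negbTE; apply: contraTneq ax => ->; rewrite -leNgt lerDl.
  have ya : (y == a) = false.
    apply/negbTE; apply: contraTneq ax => ya; rewrite -leNgt -ya.
    apply: le_trans (metric_triangle _ y _) _.
    by rewrite lerD2l metric_sym (le_trans xy)// ler_norm.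
  by rewrite /indicator xa ya subrr modulus0.
- move=> e e0; have [M [N1 hM]] := combing_proper Hc Hcoh (nrm a).
  have [N2 hN2] := combing_id Hc (Num.max M (nrm a)).
  exists (maxn N1 N2) => n x; rewrite geq_max => /andP[N1n N2n].
  have [xM|] := leP (nrm x) (Num.max M (nrm a)).
    by rewrite hN2// subrr modulus0.
  rewrite gt_max => /andP[Mx ax].
  have xa : (x == a) = false.
    by apply/negbTE; apply: contraTneq ax => ->; rewrite -leNgt.
  have Ha : (H x n == a) = false.
    apply/negbTE; apply: contraTneq Mx => Ha; rewrite -leNgt.
    by apply: (hM x n) => //; rewrite Ha.
  by rewrite /indicator xa Ha subrr modulus0.
Qed.

Lemma affine_ext_indicator s a (u : rips X s) :
  affine_ext (indicator a) u = cplx (u a).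
Proof.
have [au|au] := boolP (a \in finsupp u).
  rewrite /affine_ext (big_fsetD1 a)//= /indicator eqxx mulr1.
  rewrite big_seq big1 ?addr0//.
  by move=> x; rewrite !inE => /andP[/negbTE -> _]; rewrite mulr0.
rewrite (fsfun_dflt au) /affine_ext big_seq big1// => x xu.
by rewrite /indicator [x == a]negbTE ?mulr0//; apply: contraNneq au => <-.
Qed.

Lemma D0P (f : DH H) : f \in D0 (H := H) <->
  forall e : R, 0 < e -> exists N : R, forall x, N < nrm x ->
    modulus (val f x) < e.
Proof.
split=> [/asboolP h e e0|h].
  have [N hN] := iffLR (at_infinityP x0 _) (iffLR (cplx_cvgP _ _) h e e0).
  by exists N => x /hN /=; rewrite subr0.
apply/asboolP/(iffRL (cplx_cvgP _ _)) => e e0; apply/(at_infinityP x0).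
by have [N hN] := h e e0; exists N => x /hN /=; rewrite subr0.
Qed.

End affine_extension.

Section corona_characters.
Context (R : realType) (X : metricType R).
Hypothesis X_proper : proper_metric X.
Hypothesis X_discrete : forall x : X, open [set x].
Variables (x0 : X) (H : X -> nat -> X).
Hypothesis H_combing : is_combing x0 H.
Hypothesis H_coherent : coherent H.
Local Notation nrm x := (mdist x0 x).

Definition affine_DP s (q : rips_proj X s) (f : DH H) : DP H q :=
  exist _ (affine_ext (val f))
    (introT (asboolP _) (affine_ext_rips_fun x0 q (elimT (asboolP _) (valP f)))).

Lemma affine_DPE s (q : rips_proj X s) (f : DH H) x :
  val (affine_DP q f) (vertex s x) = val f x.
Proof. exact: affine_ext_vertex. Qed.

Definition indicator_DH (a : X) : DH H :=
  exist _ (indicator a)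
    (introT (asboolP _) (indicator_combing_fun a H_combing H_coherent)).

Lemma indicator_D0 a : indicator_DH a \in D0 (H := H).
Proof.
apply/(D0P x0) => e e0; exists (nrm a) => x ax /=.
rewrite /indicator [x == a]negbTE ?modulus0//.
by apply: contraTneq ax => ->; rewrite -leNgt.
Qed.

Section one_stage.
Variables (s : {nonneg R}) (q : rips_proj X s).
Variable chi : rips_compactification H q.

Definition coordinate (a : X) : DP H q := affine_DP q (indicator_DH a).

Lemma coordinateE a u : val (coordinate a) u = cplx (u a).
Proof. exact: affine_ext_indicator. Qed.

Lemma sum_coordinateE (t : seq X) u :
  val (\sum_(a <- t) coordinate a) u = cplx (\sum_(a <- t) u a).
Proof.
elim: t => [|a t IH]; first by rewrite !big_nil.
rewrite !big_cons; transitivity (cplx (u a) + cplx (\sum_(b <- t) u b)).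
  by rewrite -IH -coordinateE.
exact/esym/(raddfD (real_complex R)).
Qed.

Lemma sum_bary_le1 (u : rips X s) (t : {fset X}) : \sum_(a <- t) u a <= 1.
Proof.
pose b := (t `|` finsupp u)%fset.
have bE : \sum_(a <- b) u a = 1.
  rewrite -(bary_sum u) [RHS](big_fset_incl _ (fsubsetUr t _))//.
  by move=> x _ /fsfun_dflt.
rewrite -bE [leRHS](big_fsetID _ (mem t))/=.
rewrite [X in _ <= X + _](_ : _ = \sum_(a <- t) u a); last first.
  by apply: eq_fbigl => x; rewrite !inE /=; case: (x \in t); rewrite ?andbF.
by rewrite lerDl sumr_ge0// => x _; exact: bary_ge0.
Qed.

Hypothesis chi0 : forall a, val chi (coordinate a) = 0.

Lemma character_sum_coordinate (t : seq X) :
  val chi (\sum_(a <- t) coordinate a) = 0.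
Proof.
elim: t => [|a t IH].
  by rewrite big_nil -(subrr (1 : DP H q)) characterB subrr.
by rewrite big_cons -[coordinate a]scale1r character_linear chi0 IH mulr0 addr0.
Qed.

Lemma character_vanish (F : DP H q) :
  (forall e : R, 0 < e -> exists N : R, forall x, N < nrm x ->
    modulus (val F (vertex s x)) < e) -> val chi F = 0.
Proof.
move=> Fvan.
suff h (e : R) : 0 < e -> modulus (val chi F) <= e.
  have [//|c0] := eqVneq (val chi F) 0.
  have cpos : 0 < modulus (val chi F).
    rewrite lt_neqAle modulus_ge0 andbT eq_sym; apply: contra c0 => /eqP.
    by move=> /ComplexField.Normc.eq0_normc ->.
  have := h (modulus (val chi F) / 2); rewrite divr_gt0// => /(_ isT).
  by move=> ?; exfalso; lra.
move=> e0; have e20 : 0 < e / 2 by rewrite divr_gt0.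
have [_ _ vF _] := iffLR (rips_funP x0 H q _) (DP_fun F).
have [N1 hN1] := vF 0 _ e20; have [N2 hN2] := Fvan _ e20.
pose N := Num.max N1 N2.
pose t := fset_set [set x | nrm x <= N].
have tE x : (x \in t) = (nrm x <= N).
  rewrite in_fset_set; first by apply/idP/idP => [/set_mem|/mem_set].
  exact: (finite_ball X_proper X_discrete).
pose psi := \sum_(a <- t) coordinate a.
have -> : val chi F = val chi (F - F * psi).
  by rewrite characterB characterM character_sum_coordinate mulr0 subr0.
apply: (character_bound x0) => u.
have -> : val (F - F * psi) u = val F u * (1 - val psi u).
  by rewrite mulrBr mulr1.
rewrite sum_coordinateE.
have -> : 1 - cplx (\sum_(a <- t) u a) = cplx (1 - \sum_(a <- t) u a).
  by rewrite /cplx raddfB.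
rewrite modulusM modulus_cplx.
have [ut|] := boolP (finsupp u `<=` t)%fset.
  rewrite (_ : \sum_(a <- t) u a = 1) ?subrr ?normr0 ?mulr0 ?(ltW e0)//.
  rewrite -(bary_sum u) [RHS](big_fset_incl _ ut)//.
  by move=> x _ /fsfun_dflt.
move=> /fsubsetPn[x xu]; rewrite tE -ltNge gt_max => /andP[N1x N2x].
have k1 : modulus (val F u - val F (vertex s x)) < e / 2.
  by apply: (hN1 _ _ x x); rewrite ?finsupp_vertex ?inE ?mdistxx.
have k2 := hN2 x N2x.
have k3 : modulus (val F u) <= e.
  have := modulusD (val F u - val F (vertex s x)) (val F (vertex s x)).
  by rewrite subrK; lra.
rewrite -[leRHS]mulr1 ler_pM ?modulus_ge0// ger0_norm ?subr_ge0 ?sum_bary_le1//.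
by rewrite gerBl sumr_ge0// => a _; exact: bary_ge0.
Qed.

Lemma character_eq (F G : DP H q) :
  (forall e : R, 0 < e -> exists N : R, forall x, N < nrm x ->
    modulus (val F (vertex s x) - val G (vertex s x)) < e) ->
  val chi F = val chi G.
Proof.
by move=> /(@character_vanish (F - G)); rewrite characterB => /eqP;
  rewrite subr_eq0 => /eqP.
Qed.

Lemma character_eq_vertex (F G : DP H q) :
  (forall x, val F (vertex s x) = val G (vertex s x)) -> val chi F = val chi G.
Proof.
move=> FG; apply: character_eq => e e0; exists 0 => x _.
by rewrite FG subrr modulus0.
Qed.

Definition corona_fun (c : Quotient.quot (D0 (H := H))) : Cplx R :=
  val chi (affine_DP q (repr c)).

Lemma corona_funE (f : DH H) :
  corona_fun (\pi_(Quotient.quot (D0 (H := H))) f) = val chi (affine_DP q f).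
Proof.
apply: character_eq => e e0.
have : repr (\pi_(Quotient.quot (D0 (H := H))) f) - f \in D0 (H := H).
  by rewrite Quotient.idealrBE reprK.
move=> /(D0P x0)/(_ e e0)[N hN]; exists N => x Nx.
by rewrite !affine_DPE; exact: hN.
Qed.

Lemma corona_fun_character :
  is_character (corona_fun \o \pi_(Quotient.quot (D0 (H := H)))).
Proof.
split=> [c f g|] /=.
  rewrite !corona_funE -character_linear; apply: character_eq_vertex => x.
  transitivity (c * val f x + val g x); first exact: affine_DPE.
  by rewrite -(affine_DPE q f) -(affine_DPE q g).
split=> [|f g] /=; rewrite !corona_funE.
  rewrite -(character1 chi); apply: character_eq_vertex => x.
  exact: affine_DPE.
rewrite -characterM; apply: character_eq_vertex => x.
transitivity (val f x * val g x); first exact: affine_DPE.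
by rewrite -(affine_DPE q f) -(affine_DPE q g).
Qed.

Lemma corona_map_surj : exists c : corona H, corona_map q c = chi.
Proof.
have cP : (corona_fun : {ptws Quotient.quot (D0 (H := H)) -> Cplx R}) \in
    [set c : {ptws Quotient.quot (D0 (H := H)) -> Cplx R} |
      is_character (c \o \pi_(Quotient.quot (D0 (H := H))))].
  exact/mem_set/corona_fun_character.
exists (exist _ (corona_fun : {ptws Quotient.quot (D0 (H := H)) -> Cplx R}) cP).
apply: val_inj; apply/funext => F /=.
rewrite corona_funE; apply: character_eq_vertex => x.
exact: affine_DPE.
Qed.

End one_stage.

Lemma corona_map_coordinate s (q : rips_proj X s) (c : corona H) a :
  val (corona_map q c) (coordinate q a) = 0.
Proof.
have [lc _] : is_character (val c \o \pi_(Quotient.quot (D0 (H := H)))) :=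
  set_mem (valP c).
have c0 : val c (\pi_(Quotient.quot (D0 (H := H))) (0 : DH H)) = 0.
  have := lc (-1) 0 0; rewrite /= scaler0 addr0 => ->.
  by rewrite scaleN1r addNr.
rewrite /= -[RHS]c0; congr (val c _).
apply/eqP; rewrite -Quotient.idealrBE subr0.
rewrite (_ : Defs.restrict _ _ = indicator_DH a) ?indicator_D0//.
by apply: val_inj; apply/funext => x /=; exact: affine_ext_vertex.
Qed.

End corona_characters.

Section sigma_contraction.
Context (R : realType) (X : metricType R).
Hypothesis X_proper : proper_metric X.
Hypothesis X_discrete : forall x : X, open [set x].
Variables (x0 : X) (H : X -> nat -> X).
Hypothesis H_combing : is_combing x0 H.
Hypothesis H_coherent : coherent H.
Variables (L : R) (A : R -> {fset X}) (g : R -> X -> X -> R).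
Hypothesis gA : contracting_weights x0 H L A g.
Variable p : forall r : {nonneg R}, rips_proj X r.

Local Notation I := (unit_interval R).
Local Notation Y := (sigma_compactification H p).
Local Notation coord n a :=
  (coordinate H_combing H_coherent (p (nat_scale R n)) a).

Lemma sigma_coronaP n (y : Y n) :
  sigma_corona H p (sigma_in y) <-> forall a, val y (coord n a) = 0.
Proof.
rewrite (sigma_corona_stage H p n); split=> [[c _] cy a|y0].
  move: cy => /eqmodP/asboolP[k [/= nk [nk' e]]].
  have := congr1 (fun z : Y k => val z (coord k a)) e.
  rewrite (corona_map_incl (p (nat_scale R n))) corona_map_coordinate => ->.
  congr (val y _); apply: val_inj; apply/funext => u.
  by rewrite coordinateE /= affine_ext_indicator.
have [c cy] := corona_map_surj X_proper X_discrete y0.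
by exists c => //; rewrite cy.
Qed.

Lemma sigma_corona_closed : closed (sigma_corona H p).
Proof.
rewrite -[sigma_corona H p]setCK; apply: open_closedC; apply: sigma_openP => n.
rewrite (_ : [set y | _] = \bigcup_a (fun y : Y n => val y (coord n a)) @^-1`
    ~` [set 0]).
  apply: bigcup_open => a _.
  apply: (iffLR (continuousP _)
    (@max_ideal_space_eval_continuous _ _ _ (coord n a))).
  apply: closed_openC; apply/accessible_closed_set1/hausdorff_accessible.
  exact: (@norm_hausdorff _ (Cplx R)).
apply/seteqP; split=> [y /= ny|y [a _ /= ya] /sigma_coronaP/(_ a)//].
apply: contrapT => no; apply: ny; apply/sigma_coronaP => a.
by apply: contrapT => ya; apply: no; exists a.
Qed.

(* At every time [t > 0] the slide maps into a finite subcomplex, on which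
   finitely many barycentric coordinates add up to [1]. *)
Lemma slide_map_not_corona m n
    (mn : admissible g (nat_scale R m) (nat_scale R n)) (y : Y m) (t : I) : 0 < \val t ->
  ~ sigma_corona H p (@sigma_in Y n (slide_map gA (p := p) mn (y, t))).
Proof.
move=> t0 /sigma_coronaP h.
pose B := A (push_time ((\val t)^-1 - 1)).
have := character_sum_coordinate h B.
have -> : val (slide_map gA (p := p) mn (y, t)) (\sum_(a <- B) coord n a) = 1.
  rewrite -[RHS](character1 y) /=; congr (val y _); apply: val_inj.
  apply/funext => u.
  transitivity (val (\sum_(a <- B) coord n a) (slide gA mn (\val t) u)) => //.
  rewrite sum_coordinateE /slide t0 /=.
  rewrite (_ : \sum_(a <- B) _ = 1)//.
  have := bary_sum (push gA mn ((\val t)^-1 - 1) u).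
  rewrite (big_fset_incl _ (finsupp_bary_push _ _ _)) => // x _ /fsfun_dflt.
  by [].
by apply/eqP; rewrite oner_eq0.
Qed.

Lemma sigma_slide : exists h : sigma_union Y * I -> sigma_union Y,
  [/\ continuous h, forall y t, \val t = 0 -> h (y, t) = y,
    exists y0, forall y t, \val t = 1 -> h (y, t) = y0,
    forall m, exists n, forall (y : Y m) t,
      exists z : Y n, h (sigma_in y, t) = sigma_in z
  & forall y t, 0 < \val t -> ~ sigma_corona H p (h (y, t))].
Proof.
have /choice[N NP] m : exists n, (m <= n)%N /\
    forall k, (n <= k)%N -> admissible g (nat_scale R m) (nat_scale R k).
  have [s0 hs0] := admissible_large H_combing gA (nat_scale R m).
  pose n := Num.Def.archi_bound `|s0|.
  have hn : `|s0| < n%:R by exact: archi_boundP.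
  exists (maxn m n); split=> [|k]; first exact: leq_maxl.
  rewrite geq_max => /andP[_ nk]; apply: hs0 => /=.
  rewrite (le_trans (ler_norm _))// (le_trans (ltW hn))// ler_nat//.
have ok m : admissible g (nat_scale R m) (nat_scale R (N m)).
  exact: (NP m).2 (leqnn _).
pose h m (z : Y m * I) : sigma_union Y :=
  @sigma_in Y (N m) (slide_map gA (p := p) (ok m) z).
have h_later m k (mk : admissible g (nat_scale R m) (nat_scale R k)) :
    (N m <= k)%N -> forall y t,
    h m (y, t) = @sigma_in Y k (slide_map gA (p := p) mk (y, t)).
  move=> Nk y t; rewrite /h -(@sigma_in_transition Y _ _ Nk); congr sigma_in.
  rewrite /= (slide_map_incl gA (p := p) (ok m) mk (lexx _)); congr slide_map.
  congr pair; apply: val_inj; apply/funext => f /=; congr (val y _).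
  by apply: val_inj; apply/funext => u /=; congr (val f _); exact: rips_eq.
have h_continuous m : continuous (h m).
  have sigma_in_continuous n : continuous (@sigma_in Y n).
    by apply/continuousP => W oW; exact: (iffLR (sigT_openP _) oW n).
  move=> z; apply: continuous_comp; last exact: sigma_in_continuous.
  exact: slide_map_continuous.
have h_transition m n (mn : (m <= n)%N) (y : Y m) t :
    h n (transition mn y, t) = h m (y, t).
  pose k := maxn (N m) (N n).
  have mk := (NP m).2 k (leq_maxl _ _); have nk := (NP n).2 k (leq_maxr _ _).
  rewrite (h_later n k nk (leq_maxr _ _)) (h_later m k mk (leq_maxl _ _)).
  rewrite /= -(slide_map_incl gA (p := p) mk nk _ (lexx _)).
  apply: (congr1 (@sigma_in Y k)).
  apply: val_inj; apply/funext => f /=; congr (val y _); apply: val_inj.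
  by apply/funext => u /=; congr (val f _); exact: rips_eq.
have hE := sigma_homotopyE h_transition.
exists (sigma_homotopy h); split.
- exact: sigma_homotopy_continuous.
- move=> z t t0; have [m [y ->]] := sigma_unionP z; rewrite hE /h slide_map0//.
  rewrite -[RHS](@sigma_in_transition Y _ _ (NP m).1 y).
  apply: (congr1 (@sigma_in Y (N m))); congr (compactification_incl _ _ _ y).
  exact: Prop_irrelevance.
- exists (@sigma_in Y 0 (eval_character H p (vertex (nat_scale R 0) x0))).
  move=> z t t1; have [m [y ->]] := sigma_unionP z; rewrite hE /h slide_map1//.
  rewrite -(@sigma_in_transition Y _ _ (leq0n (N m))); congr sigma_in.
  apply: val_inj; apply/funext => f /=; congr (val f _).
  exact/esym/rips_incl_vertex.
- move=> m; exists (N m) => y t; rewrite hE.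
  by exists (slide_map gA (p := p) (ok m) (y, t)).
- move=> z t t0; have [m [y ->]] := sigma_unionP z; rewrite hE.
  exact: slide_map_not_corona.
Qed.

End sigma_contraction.

Theorem theorem1 (R : realType) (X : metricType R)
    (X_proper : proper_metric X) (X_discrete : forall x : X, open [set x])
    (x0 : X) (H : X -> nat -> X)
    (H_combing : is_combing x0 H)
    (H_expanding : expanding H) (H_coherent : coherent H)
    (p : forall r : {nonneg R}, rips_proj X r) :
  [/\ forall r : {nonneg R}, 0 < r%:num ->
        exists (s : {nonneg R}) (rs : r%:num < s%:num)
               (b : rips_compactification H (p s)),
          homotopic R (compactification_incl (p r) (p s) (ltW rs)) (cst b),
      sigma_contractible R (sigma_compactification H p)
    & Z_set R (sigma_corona H p)].
Proof.
have [L [A [g gA]]] := exists_contracting_weights X_proper X_discrete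
  H_combing H_expanding H_coherent.
have [h [ch h0 h1 hs hZ]] := sigma_slide X_proper X_discrete H_combing
  H_coherent gA p.
split=> [r r0||].
- have [s0 hs0] := admissible_large H_combing gA r.
  have s_ge0 : 0 <= `|s0| + r%:num + 1 by rewrite !addr_ge0// ltW.
  pose s : {nonneg R} := NngNum s_ge0.
  have rs : r%:num < s%:num by rewrite /= -addrA ltr_wpDl// ltrDl.
  have adm : admissible g r s.
    by apply: hs0; rewrite /= (le_trans (ler_norm _))// -addrA lerDl addr_ge0.
  exists s, rs, (eval_character H p (vertex s x0)).
  exists (slide_map gA (p := p) adm); split.
  + exact: slide_map_continuous.
  + move=> y t t0; rewrite slide_map0//; congr (compactification_incl _ _ _ y).
    exact: Prop_irrelevance.
  + by move=> y t t1; rewrite slide_map1.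
- by exists h.
split; last by exists h.
exact: (sigma_corona_closed X_proper X_discrete H_combing H_coherent).
Qed.
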